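(* Let $P=\prod_{j=1}^k(x\partial_x-r_j)$ with $r_1,\dots,r_k\in\mathbb{Q}$ (and $r_j\in R$), let $D_1,\dots,D_N\in\mathrm{Diff}=R[x^{\pm1},\partial_x]$, and let $$A=P^{-1}D_1P^{-1}D_2\cdots D_NP^{-1}\in\overline{\mathrm{Diff}}.$$ Then there is a constant $C$ depending only on $A$ such that for all primes $p>C$ $$\operatorname{tr}\big(\rho_{p,\xi,\eta}(A)\big)=T_{\varepsilon}\,\mathrm{Coef}_{x^{\varepsilon}}\big(\rho_{\varepsilon}(A)x^{\varepsilon}\big)\Big|_{\varepsilon=-\xi^p\eta^p}\mod p .$$
   Context: Let $\mathbf{k}$ be a field of characteristic zero with algebraic closure $\bar{\mathbf{k}}$, and $R\subset\mathbf{k}$ a subring finitely generated over $\mathbb{Z}$ containing $r_1,\dots,r_k\in\mathbb{Q}$. $\mathrm{Diff}=R[x^{\pm1},\partial_x]$ is the ring of differential operators ($\partial_xx-x\partial_x=1$), and $$\overline{\mathrm{Diff}}=R[x^{\pm1},\partial_x,(x\partial_x-r_i+m)^{-1},\ 1\le i\le k,\ m\in\mathbb{Z}]$$ is obtained by adjoining two-sided inverses. Its elements are written uniquely as finite sums $\sum_j x^jf_j(x\partial_x)$ with $f_j$ rational functions, multiplied by the rule $f(x\partial_x)x^j=x^jf(x\partial_x+j)$. For a large enough prime $p$ and formal parameters $\xi,\eta$, the $p$-dimensional representation $\rho_{p,\xi,\eta}$ of $\overline{\mathrm{Diff}}$ on $R/(p)(\xi,\eta)[x]/(x^p)$ is given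 by $\rho_{p,\xi,\eta}(x)=x+\xi$, $\rho_{p,\xi,\eta}(\partial_x)=\partial_x+\eta$ (the required inverses exist already over $R/(p)[\xi^{\pm1},\eta^{\pm1}]$). For a formal parameter $\varepsilon$, $\rho_\varepsilon$ is the representation of $\overline{\mathrm{Diff}}$ on the $\mathbf{k}(\varepsilon)$-vector space with basis $\{x^{\varepsilon+m}: m\in\mathbb{Z}\}$ given by $\rho_\varepsilon(x)x^{\varepsilon+m}=x^{\varepsilon+m+1}$, $\rho_\varepsilon(\partial_x)x^{\varepsilon+m}=(\varepsilon+m)x^{\varepsilon+m-1}$. $\mathrm{Coef}_{x^\varepsilon}$ is the coefficient of the basis vector $x^\varepsilon$. $T_\varepsilon:\bar{\mathbf{k}}(\varepsilon)\to\bar{\mathbf{k}}(\varepsilon)$ is the $\bar{\mathbf{k}}$-linear operator (defined via partial fractions) with $T_\varepsilon(\varepsilon^i)=0$ for $i\ge0$ and $T_\varepsilon\big((\varepsilon-c)^{-j}\big)=\varepsilon^{-j}$ for $j>0$, $c\in\bar{\mathbf{k}}$; it preserves $\mathbf{k}(\varepsilon)$. ''mod $p$'' on the right-hand side: the expression has coefficients in $R[1/m]$ for some integer $m\geq 1$ and is reduced modulo primes $p$ not dividing $m$. *)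

(* Defs.v *)
From HB Require Import structures.
From mathcomp Require Import all_boot all_order all_algebra.
From mathcomp Require Import generic_quotient ring_quotient fraction.
From mathcomp Require Import finmap monalg.
From mathcomp Require Import boolp.
From mathcomp Require Import ring.

Set Implicit Arguments.
Unset Strict Implicit.
Unset Printing Implicit Defensive.

Import GRing.Theory.
Local Open Scope ring_scope.
Local Open Scope quotient_scope.

Notation "x %:F" := (@FracField.tofrac _ x) : ring_scope.

Section FracMap.
Variables (R S : idomainType) (f : {rmorphism R -> S}).

Definition frac_map (z : {fraction R}) : {fraction S} :=
  (f \n_(repr z))%:F / (f \d_(repr z))%:F.

Hypothesis f_inj : injective f.

Lemma frac_numden (A : idomainType) (z : {fraction A}) :
  z = (\n_(repr z))%:F / (\d_(repr z))%:F.
Proof.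
have d0 : (\d_(repr z))%:F != 0 by rewrite tofrac_eq0 denom_ratioP.
apply: (canRL (mulfK d0)) => {d0}.
rewrite -[X in X * _]reprK; case: (repr z) => -[n d] /= d0.
unlock FracField.tofrac; rewrite -[LHS]FracField.pi_mul.
apply/eqmodP; rewrite /= FracField.equivfE /FracField.mulf.
by rewrite !numden_Ratio ?mulf_neq0 ?oner_neq0 ?mulr1 //= mulrC.
Qed.

Lemma fracP (A : idomainType) (z : {fraction A}) :
  exists n d : A, d != 0 /\ z = n%:F / d%:F.
Proof.
by exists \n_(repr z), \d_(repr z); split; [exact: denom_ratioP|exact: frac_numden].
Qed.

Lemma frac_mapE (n d : R) : d != 0 ->
  frac_map (n%:F / d%:F) = (f n)%:F / (f d)%:F.
Proof.
move=> d0; rewrite /frac_map; set z : {fraction R} := n%:F / d%:F.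
have e0 : \d_(repr z) != 0 by exact: denom_ratioP.
have fE (e : R) : e != 0 -> (f e)%:F != 0.
  by move=> eN0; rewrite tofrac_eq0 -(rmorph0 f) (inj_eq f_inj).
apply/eqP; rewrite eqr_div ?fE //.
rewrite -!tofracM -!rmorphM /= tofrac_eq (inj_eq f_inj).
rewrite -tofrac_eq !tofracM -eqr_div ?tofrac_eq0 //.
by rewrite -frac_numden.
Qed.

Lemma frac_map_tofrac (a : R) : frac_map a%:F = (f a)%:F.
Proof.
have -> : a%:F = a%:F / 1%:F :> {fraction R} by rewrite tofrac1 divr1.
by rewrite frac_mapE ?oner_neq0 // rmorph1 tofrac1 divr1.
Qed.

Lemma frac_map_is_zmod_morphism : zmod_morphism frac_map.
Proof.
move=> x y; have [a [b [b0 ->]]] := fracP x; have [c [d [d0 ->]]] := fracP y.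
have fE (e : R) : e != 0 -> (f e)%:F != 0.
  by move=> eN0; rewrite tofrac_eq0 -(rmorph0 f) (inj_eq f_inj).
rewrite -mulNr addf_div ?tofrac_eq0 // -!tofracN -!tofracM -tofracD.
rewrite !frac_mapE ?mulf_neq0 // -mulNr addf_div ?fE //.
by rewrite -!tofracN -!tofracM -tofracD !rmorphD !rmorphM rmorphN.
Qed.

Lemma frac_map_is_monoid_morphism : monoid_morphism frac_map.
Proof.
split=> [|x y]; first by rewrite -!tofrac1 frac_map_tofrac rmorph1.
have [a [b [b0 ->]]] := fracP x; have [c [d [d0 ->]]] := fracP y.
rewrite mulf_div -!tofracM !frac_mapE ?mulf_neq0 //.
by rewrite mulf_div -!tofracM !rmorphM.
Qed.

End FracMap.

Section TotalFractions.
Variable A : comNzRingType.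

Record tratio := TRatio { tfrac :> A * A; _ : `[< GRing.lreg tfrac.2 >] }.
HB.instance Definition _ := [isSub for tfrac].
HB.instance Definition _ := [Choice of tratio by <:].

Lemma tratioP (x : tratio) : GRing.lreg (tfrac x).2.
Proof. by case: x => x /= /asboolP. Qed.
Arguments tratioP : clear implicits.

Definition mkt (a b : A) (h : GRing.lreg b) : tratio :=
  @TRatio (a, b) (introT (asboolP _) h).

Definition tequiv (x y : tratio) : bool :=
  (tfrac x).1 * (tfrac y).2 == (tfrac x).2 * (tfrac y).1.

Lemma tequiv_refl : reflexive tequiv.
Proof. by move=> x; rewrite /tequiv mulrC. Qed.

Lemma tequiv_sym : symmetric tequiv.
Proof.
by move=> x y; rewrite /tequiv eq_sym; congr (_ == _); rewrite mulrC.
Qed.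

Lemma tequiv_trans : transitive tequiv.
Proof.
move=> y x z; rewrite /tequiv => /eqP xy /eqP yz; apply/eqP.
apply: (tratioP y) => /=.
have -> : (tfrac y).2 * ((tfrac x).1 * (tfrac z).2) =
  ((tfrac x).1 * (tfrac y).2) * (tfrac z).2 by ring.
rewrite xy -mulrA yz; ring.
Qed.

Canonical tequiv_equiv := EquivRel tequiv tequiv_refl tequiv_sym tequiv_trans.

(* The total ring of fractions of A: pairs (a, s) with s a nonzerodivisor,    *)
(* modulo (a, s) ~ (b, t) iff a t = s b.                                      *)
Definition total_fraction := {eq_quot tequiv}.
HB.instance Definition _ : EqQuotient _ tequiv total_fraction :=
  EqQuotient.on total_fraction.
HB.instance Definition _ := Choice.on total_fraction.

Lemma tequivP (x y : tratio) :
  reflect ((tfrac x).1 * (tfrac y).2 = (tfrac x).2 * (tfrac y).1)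
          (x == y %[mod total_fraction]).
Proof. by rewrite eqmodE; apply: eqP. Qed.

Lemma tequiv_repr (x : tratio) :
  (tfrac x).1 * (tfrac (repr (\pi_total_fraction x))).2 =
  (tfrac x).2 * (tfrac (repr (\pi_total_fraction x))).1.
Proof. by apply/tequivP; rewrite reprK. Qed.

Definition to_total_fraction :=
  lift_embed total_fraction (fun a : A => mkt a (@GRing.lreg1 A)).
Canonical to_total_fraction_pi_morph := PiEmbed to_total_fraction.

Definition taddr (x y : tratio) : tratio :=
  mkt ((tfrac x).1 * (tfrac y).2 + (tfrac y).1 * (tfrac x).2)
      (GRing.lregM (tratioP x) (tratioP y)).
Definition tadd := lift_op2 total_fraction taddr.
Lemma pi_tadd : {morph \pi : x y / taddr x y >-> tadd x y}.
Proof.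
move=> x y; unlock tadd; apply/eqP/tequivP => /=.
have := tequiv_repr x; have := tequiv_repr y.
case: (tfrac x) (tfrac y) => [a b] [c d] /=.
case: (tfrac (repr _)) => c' d' /= cd; case: (tfrac (repr _)) => a' b' /= ab.
have -> : (a * d + c * b) * (b' * d') = (a * b') * (d * d') + (c * d') * (b * b').
  by ring.
rewrite ab cd; ring.
Qed.
Canonical pi_tadd_morph := PiMorph2 pi_tadd.

Definition toppr (x : tratio) : tratio := mkt (- (tfrac x).1) (tratioP x).
Definition topp := lift_op1 total_fraction toppr.
Lemma pi_topp : {morph \pi : x / toppr x >-> topp x}.
Proof.
move=> x; unlock topp; apply/eqP/tequivP => /=.
by rewrite mulNr tequiv_repr mulrN.
Qed.
Canonical pi_topp_morph := PiMorph1 pi_topp.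

Definition tmulr (x y : tratio) : tratio :=
  mkt ((tfrac x).1 * (tfrac y).1) (GRing.lregM (tratioP x) (tratioP y)).
Definition tmul := lift_op2 total_fraction tmulr.
Lemma pi_tmul : {morph \pi : x y / tmulr x y >-> tmul x y}.
Proof.
move=> x y; unlock tmul; apply/eqP/tequivP => /=.
by rewrite mulrACA !tequiv_repr mulrACA.
Qed.
Canonical pi_tmul_morph := PiMorph2 pi_tmul.

Local Notation "a %:T" := (to_total_fraction a).

Lemma taddA : associative tadd.
Proof.
elim/quotW=> x; elim/quotW=> y; elim/quotW=> z; rewrite !piE.
by apply/eqP/tequivP => /=; ring.
Qed.

Lemma taddC : commutative tadd.
Proof.
elim/quotW=> x; elim/quotW=> y; rewrite !piE.
by apply/eqP/tequivP => /=; ring.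
Qed.

Lemma tadd0 : left_id 0%:T tadd.
Proof.
by elim/quotW=> x; rewrite !piE; apply/eqP/tequivP => /=; ring.
Qed.

Lemma taddN : left_inverse 0%:T topp tadd.
Proof.
by elim/quotW=> x; rewrite !piE; apply/eqP/tequivP => /=; ring.
Qed.

HB.instance Definition _ :=
  GRing.isZmodule.Build total_fraction taddA taddC tadd0 taddN.

Lemma tmulA : associative tmul.
Proof.
elim/quotW=> x; elim/quotW=> y; elim/quotW=> z; rewrite !piE.
by apply/eqP/tequivP => /=; ring.
Qed.

Lemma tmulC : commutative tmul.
Proof.
elim/quotW=> x; elim/quotW=> y; rewrite !piE.
by apply/eqP/tequivP => /=; ring.
Qed.

Lemma tmul1 : left_id 1%:T tmul.
Proof.
by elim/quotW=> x; rewrite !piE; apply/eqP/tequivP => /=; ring.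
Qed.

Lemma tmulDl : left_distributive tmul tadd.
Proof.
elim/quotW=> x; elim/quotW=> y; elim/quotW=> z; rewrite !piE.
by apply/eqP/tequivP => /=; ring.
Qed.

Lemma toner_neq0 : 1%:T != 0%:T :> total_fraction.
Proof.
by rewrite piE /= /tequiv /= mulr1 mulr0 oner_eq0.
Qed.

HB.instance Definition _ := GRing.Zmodule_isComNzRing.Build total_fraction
  tmulA tmulC tmul1 tmulDl toner_neq0.

Definition tunit : pred total_fraction :=
  fun z => `[< exists w : total_fraction, w * z = 1 >].

Definition tinv (z : total_fraction) : total_fraction :=
  if pselect (exists w : total_fraction, w * z = 1) is left h
  then projT1 (cid h) else z.

Lemma tmulVr : {in tunit, left_inverse 1 tinv *%R}.
Proof.
move=> z /asboolP h; rewrite /tinv; case: pselect => // h'.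
by case: (cid h').
Qed.

Lemma tunitP (z w : total_fraction) : w * z = 1 -> tunit z.
Proof. by move=> h; apply/asboolP; exists w. Qed.

Lemma tinv_out : {in [predC tunit], tinv =1 id}.
Proof.
by move=> z /asboolP h; rewrite /tinv; case: pselect => // h'; case: h.
Qed.

HB.instance Definition _ := GRing.ComNzRing_hasMulInverse.Build total_fraction
  tmulVr tunitP tinv_out.

Lemma to_total_fraction_is_zmod_morphism : zmod_morphism to_total_fraction.
Proof.
move=> a b; rewrite -[RHS]/(tadd _ (topp _)) !piE.
by apply/eqP/tequivP => /=; ring.
Qed.

Lemma to_total_fraction_is_monoid_morphism : monoid_morphism to_total_fraction.
Proof.
split=> // a b; rewrite -[RHS]/(tmul _ _) !piE.
by apply/eqP/tequivP => /=; ring.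
Qed.

HB.instance Definition _ := GRing.isZmodMorphism.Build A total_fraction
  to_total_fraction to_total_fraction_is_zmod_morphism.
HB.instance Definition _ := GRing.isMonoidMorphism.Build A total_fraction
  to_total_fraction to_total_fraction_is_monoid_morphism.

Lemma to_total_fraction_inj : injective to_total_fraction.
Proof.
by move=> a b; rewrite !piE => /eqP/tequivP /=; rewrite mulr1 mul1r.
Qed.

Lemma to_total_fraction_unit (s : A) :
  GRing.lreg s -> to_total_fraction s \is a GRing.unit.
Proof.
move=> sreg; apply/asboolP; exists (\pi_total_fraction (mkt 1 sreg)).
rewrite -[LHS]/(tmul _ _) -[RHS]/(1%:T) !piE.
by apply/eqP/tequivP => /=; ring.
Qed.

Lemma total_fractionP (z : total_fraction) :
  exists a s : A, GRing.lreg s /\ z * to_total_fraction s = to_total_fraction a.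
Proof.
elim/quotW: z => -[[a s] /= sreg]; exists a, s; split; first exact/asboolP.
rewrite -[LHS]/(tmul _ _) !piE.
by apply/eqP/tequivP => /=; ring.
Qed.

End TotalFractions.

Section DiffOp.
Variable k : fieldType.

Local Notation F := {fraction {poly k}}.

Lemma comp_poly_shift_inj (m : int) : injective (comp_poly ('X + (m%:~R : k)%:P)).
Proof.
move=> p q /(congr1 (comp_poly ('X - (m%:~R : k)%:P))) /=.
by rewrite -!comp_polyA !comp_polyD !comp_polyX !comp_polyC !addrNK !comp_polyXr.
Qed.

(* f(t) |-> f(t + m) on k(t)                                                  *)
Definition frac_shift (m : int) : F -> F :=
  frac_map (comp_poly ('X + (m%:~R : k)%:P)).

HB.instance Definition _ m := GRing.isZmodMorphism.Build F F (frac_shift m)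
  (frac_map_is_zmod_morphism (@comp_poly_shift_inj m)).
HB.instance Definition _ m := GRing.isMonoidMorphism.Build F F (frac_shift m)
  (frac_map_is_monoid_morphism (@comp_poly_shift_inj m)).

Lemma frac_shift_tofrac m (p : {poly k}) :
  frac_shift m p%:F = (p \Po ('X + (m%:~R : k)%:P))%:F.
Proof. exact: (frac_map_tofrac (@comp_poly_shift_inj m)). Qed.

Lemma frac_shiftE m (n d : {poly k}) : d != 0 ->
  frac_shift m (n%:F / d%:F) =
  (n \Po ('X + (m%:~R : k)%:P))%:F / (d \Po ('X + (m%:~R : k)%:P))%:F.
Proof. exact: (frac_mapE (@comp_poly_shift_inj m)). Qed.

Lemma frac_shift0 (f : F) : frac_shift 0 f = f.
Proof.
have [n [d [d0 ->]]] := fracP f; rewrite frac_shiftE //.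
by rewrite addr0 !comp_polyXr.
Qed.

Lemma frac_shiftD i j (f : F) : frac_shift i (frac_shift j f) = frac_shift (i + j) f.
Proof.
have [n [d [d0 ->]]] := fracP f; have dj0 : d \Po ('X + (j%:~R : k)%:P) != 0.
  by rewrite comp_poly2_eq0 // size_XaddC.
rewrite [frac_shift j _]frac_shiftE // (frac_shiftE i _ dj0) (frac_shiftE _ _ d0).
rewrite -!comp_polyA !comp_polyD !comp_polyX !comp_polyC.
by rewrite intrD polyCD addrA.
Qed.

(* Finite sums of x^j f_j(x d/dx) with f_j in k(t): [<< f *g j >>] stands for *)
(* x^j f(x d/dx), and the product follows f(x d/dx) x^j = x^j f(x d/dx + j).  *)
Definition diffop := {malg F[int]}.
HB.instance Definition _ := GRing.Zmodule.on diffop.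

Implicit Types a b c : diffop.

Definition dmul a b : diffop :=
  \sum_(i <- msupp a) \sum_(j <- msupp b)
    << frac_shift j a@_i * b@_j *g i + j >>.

Local Notation dmulU i j u v := << frac_shift j u * v *g i + j >>.

Lemma dmulw (A B : {fset int}) a b :
  (msupp a `<=` A)%fset -> (msupp b `<=` B)%fset ->
  dmul a b = \sum_(i <- A) \sum_(j <- B) dmulU i j a@_i b@_j.
Proof.
move=> sA sB; rewrite /dmul (big_fset_incl _ sA) /=; last first.
  move=> i _ /mcoeff_outdom ->; rewrite big1 // => j _.
  by rewrite rmorph0 mul0r monalgU0.
apply: eq_bigr => i _; rewrite (big_fset_incl _ sB) //=.
by move=> j _ /mcoeff_outdom ->; rewrite mulr0 monalgU0.
Qed.

Lemma dmulDl : left_distributive dmul +%R.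
Proof.
move=> a b c; rewrite (dmulw (msuppD_le a b) (fsubset_refl _)).
rewrite (@dmulw (msupp a `|` msupp b)%fset (msupp c) a c) ?fsubsetUl //.
rewrite (@dmulw (msupp a `|` msupp b)%fset (msupp c) b c) ?fsubsetUr //.
rewrite -big_split /=; apply: eq_bigr => i _.
rewrite -big_split /=; apply: eq_bigr => j _.
by rewrite mcoeffD rmorphD mulrDl monalgUD.
Qed.

Lemma dmulDr : right_distributive dmul +%R.
Proof.
move=> c a b; rewrite (dmulw (fsubset_refl _) (msuppD_le a b)).
rewrite (@dmulw (msupp c) (msupp a `|` msupp b)%fset c a) ?fsubsetUl //.
rewrite (@dmulw (msupp c) (msupp a `|` msupp b)%fset c b) ?fsubsetUr //.
rewrite -big_split /=; apply: eq_bigr => i _.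
rewrite -big_split /=; apply: eq_bigr => j _.
by rewrite mcoeffD mulrDr monalgUD.
Qed.

Lemma dmulUU i j (u v : F) :
  dmul << u *g i >> << v *g j >> = dmulU i j u v.
Proof.
rewrite (dmulw msuppU_le msuppU_le) big_seq_fset1 big_seq_fset1.
by rewrite !mcoeffUU.
Qed.

Lemma dmul0l a : dmul 0 a = 0.
Proof. by rewrite /dmul msupp0 big_seq_fset0. Qed.

Lemma dmul0r a : dmul a 0 = 0.
Proof. by rewrite /dmul msupp0 big1 // => i _; rewrite big_seq_fset0. Qed.

Lemma diffop_ind (Q : diffop -> Prop) : Q 0 ->
  (forall a b, Q a -> Q b -> Q (a + b)) -> (forall u i, Q << u *g i >>) ->
  forall a, Q a.
Proof. by move=> Q0 QD QU a; rewrite [a]monalgE; elim/big_ind: _. Qed.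

Lemma dmulA : associative dmul.
Proof.
move=> a b c; elim/diffop_ind: a => [|a a' ha ha'|u i].
- by rewrite !dmul0l.
- by rewrite !dmulDl ha ha'.
elim/diffop_ind: b => [|b b' hb hb'|v j].
- by rewrite dmul0l dmul0r dmul0l.
- by rewrite dmulDl !dmulDr dmulDl hb hb'.
elim/diffop_ind: c => [|c c' hc hc'|w l].
- by rewrite !dmul0r.
- by rewrite !dmulDr hc hc'.
rewrite !dmulUU rmorphM /= frac_shiftD !mulrA addrA.
by rewrite [l + j]addrC.
Qed.

Definition dop1 : diffop := << 1 *g 0 >>.

Lemma dmul1l : left_id dop1 dmul.
Proof.
move=> a; elim/diffop_ind: a => [|a b ha hb|u i]; first exact: dmul0r.
  by rewrite dmulDr ha hb.
by rewrite dmulUU rmorph1 mul1r add0r.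
Qed.

Lemma dmul1r : right_id dop1 dmul.
Proof.
move=> a; elim/diffop_ind: a => [|a b ha hb|u i]; first exact: dmul0l.
  by rewrite dmulDl ha hb.
by rewrite dmulUU frac_shift0 mulr1 addr0.
Qed.

Lemma dop1_neq0 : dop1 != 0.
Proof. by rewrite monalgU_eq0 oner_eq0. Qed.

HB.instance Definition _ := GRing.Zmodule_isNzRing.Build diffop
  dmulA dmul1l dmul1r dmulDl dmulDr dop1_neq0.

Definition dunit : pred diffop :=
  fun a => `[< exists b : diffop, b * a = 1 /\ a * b = 1 >].

Definition dinv a : diffop :=
  if pselect (exists b : diffop, b * a = 1 /\ a * b = 1) is left h
  then projT1 (cid h) else a.

Lemma dmulVr : {in dunit, left_inverse 1 dinv *%R}.
Proof.
move=> a /asboolP h; rewrite /dinv; case: pselect => // h'.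
by case: (cid h') => b [].
Qed.

Lemma ddivrr : {in dunit, right_inverse 1 dinv *%R}.
Proof.
move=> a /asboolP h; rewrite /dinv; case: pselect => // h'.
by case: (cid h') => b [].
Qed.

Lemma dunitP a b : b * a = 1 /\ a * b = 1 -> dunit a.
Proof. by move=> h; apply/asboolP; exists b. Qed.

Lemma dinv_out : {in [predC dunit], dinv =1 id}.
Proof.
by move=> a /asboolP h; rewrite /dinv; case: pselect => // h'; case: h.
Qed.

HB.instance Definition _ := GRing.NzRing_hasMulInverse.Build diffop
  dmulVr ddivrr dunitP dinv_out.

(* f(x d/dx), x, d/dx = x^-1 (x d/dx), and the constant c                     *)
Definition fop (f : F) : diffop := << f *g 0 >>.
Definition xop : diffop := << 1 *g 1 >>.
Definition dop : diffop := << 'X%:F *g -1 >>.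
Definition cop (c : k) : diffop := fop c%:P%:F.

Lemma diffopMU i j (u v : F) :
  (<< u *g i >> : diffop) * << v *g j >> = dmulU i j u v.
Proof. exact: dmulUU. Qed.

Lemma fopD f g : fop (f + g) = fop f + fop g.
Proof. exact: monalgUD. Qed.

Lemma fopM f g : fop (f * g) = fop f * fop g.
Proof. by rewrite diffopMU frac_shift0. Qed.

Lemma fop1 : fop 1 = 1.
Proof. by []. Qed.

Lemma fop_unit f : f != 0 -> fop f \is a GRing.unit.
Proof.
by move=> f0; apply/unitrP; exists (fop f^-1); rewrite -!fopM mulVf ?mulfV.
Qed.

Lemma fopV f : f != 0 -> (fop f)^-1 = fop f^-1.
Proof.
move=> f0; apply: (mulrI (fop_unit f0)).
by rewrite divrr ?fop_unit // -fopM mulfV.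
Qed.

Lemma xop_unit : xop \is a GRing.unit.
Proof.
apply/unitrP; exists << 1 *g -1 >>.
by rewrite !diffopMU !rmorph1 mulr1 addNr addrN.
Qed.

Lemma xopV : xop^-1 = << 1 *g -1 >>.
Proof.
apply: (mulrI xop_unit); rewrite divrr ?xop_unit // diffopMU.
by rewrite rmorph1 mulr1 addrN.
Qed.

Lemma xop_dop : xop * dop = fop 'X%:F.
Proof. by rewrite diffopMU rmorph1 mul1r addrN. Qed.

Lemma dop_xop : dop * xop - xop * dop = 1.
Proof.
rewrite xop_dop diffopMU mulr1 addNr frac_shift_tofrac comp_polyX.
by rewrite -raddfB /= -rmorphB /= addrAC subrr add0r.
Qed.

End DiffOp.

Section Subrings.
Variable A : nzRingType.

Definition subring_gen (X : A -> Prop) : {pred A} :=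
  fun b => `[< forall S : subringClosed A,
                 (forall a, X a -> a \in S) -> b \in S >].

Lemma subring_gen_closed X : subring_closed (subring_gen X).
Proof.
split=> [|a b /asboolP ha /asboolP hb|a b /asboolP ha /asboolP hb];
  apply/asboolP => S hS.
- exact: rpred1.
- by rewrite rpredB ?ha ?hb.
- by rewrite rpredM ?ha ?hb.
Qed.

HB.instance Definition _ X :=
  GRing.isSubringClosed.Build A (subring_gen X) (subring_gen_closed X).

Lemma mem_subring_gen (X : A -> Prop) a : X a -> a \in subring_gen X.
Proof. by move=> Xa; apply/asboolP => S; apply. Qed.

End Subrings.

Section SubringType.
Variables (k : fieldType) (R : subringClosed k).

Definition subring_type := {c : k | c \in R}.
HB.instance Definition _ := SubChoice.on subring_type.
HB.instance Definition _ :=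
  [SubChoice_isSubComNzRing of subring_type by <:].

Definition fin_gen_over_Z : Prop :=
  exists s : seq k, R =i subring_gen (fun c => c \in s).

End SubringType.

Section DiffBar.
Variables (k : fieldType) (R : subringClosed k).

Variant Diff_generator : diffop k -> Prop :=
  | Diff_scalar c of c \in R : Diff_generator (cop c)
  | Diff_x : Diff_generator (xop k)
  | Diff_xV : Diff_generator (xop k)^-1
  | Diff_d : Diff_generator (dop k).

Definition Diff : {pred diffop k} := subring_gen Diff_generator.
HB.instance Definition _ := GRing.SubringClosed.on Diff.

Variables (n : nat) (r : 'I_n -> rat).

Variant Diffbar_generator : diffop k -> Prop :=
  | Diffbar_Diff a of Diff_generator a : Diffbar_generator a
  | Diffbar_inv (i : 'I_n) (m : int) : Diffbar_generator
      (xop k * dop k - cop (ratr (r i)) + m%:~R)^-1.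

Definition Diffbar_pred : {pred diffop k} := subring_gen Diffbar_generator.
HB.instance Definition _ := GRing.SubringClosed.on Diffbar_pred.

Definition Diffbar := {a : diffop k | a \in Diffbar_pred}.
HB.instance Definition _ := SubChoice.on Diffbar.
HB.instance Definition _ := [SubChoice_isSubNzRing of Diffbar by <:].

Definition opP : diffop k := \prod_(j < n) (xop k * dop k - cop (ratr (r j))).

Lemma fop_int (m : int) : (m%:~R : diffop k) = fop m%:~R.
Proof.
have fopB (f g : {fraction {poly k}}) : fop (f - g) = fop f - fop g.
  exact: monalgUB.
have fopn (l : nat) : fop l%:R = l%:R :> diffop k.
  by elim: l => [|l IH]; [exact: monalgU0 | rewrite !mulrSr fopD IH].
case: m => l; first by rewrite -pmulrn fopn.
by rewrite NegzE !mulrNz -(sub0r (_%:~R : {fraction _})) fopB -pmulrn fopn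
  pmulrn [fop 0]monalgU0 sub0r.
Qed.

Lemma theta_shiftE (c : k) (m : int) :
  xop k * dop k - cop c + m%:~R = fop ('X - c%:P + m%:~R%:P)%:F.
Proof.
rewrite xop_dop fop_int tofracD tofracB fopD; congr (_ + _).
  exact/esym/monalgUB.
by congr fop; rewrite !rmorph_int.
Qed.

Lemma theta_shift_unit (c : k) (m : int) :
  xop k * dop k - cop c + m%:~R \is a GRing.unit.
Proof.
rewrite theta_shiftE fop_unit // tofrac_eq0 -addrA [- _ + _]addrC -opprB -polyCB.
by rewrite polyXsubC_eq0.
Qed.

Lemma opP_unit : opP \is a GRing.unit.
Proof.
apply: rpred_prod => j _.
by have := theta_shift_unit (ratr (r j)) 0; rewrite addr0.
Qed.

Lemma opPV_Diffbar : opP^-1 \in Diffbar_pred.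
Proof.
have [] : opP \is a GRing.unit /\ opP^-1 \in Diffbar_pred; last by [].
rewrite /opP; elim/big_ind: _ => [|a b [ua ha] [ub hb]|j _].
- by rewrite unitr1 invr1 rpred1.
- split; first by rewrite (unitrMr _ ua).
  rewrite (invrM ua ub); apply: rpredM; [exact: hb | exact: ha].
split; first by have := theta_shift_unit (ratr (r j)) 0; rewrite addr0.
by apply: mem_subring_gen; have := Diffbar_inv j 0; rewrite addr0.
Qed.

Lemma sub_Diff_Diffbar : {subset Diff <= Diffbar_pred}.
Proof.
move=> a /asboolP h; apply: (h Diffbar_pred) => b hb.
exact/mem_subring_gen/Diffbar_Diff.
Qed.

Definition opA (N : nat) (D : 'I_N -> diffop k) : diffop k :=
  opP^-1 * \prod_(i < N) (D i * opP^-1).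

Lemma opA_Diffbar N (D : 'I_N -> diffop k) :
  (forall i, D i \in Diff) -> opA D \in Diffbar_pred.
Proof.
move=> hD; rewrite rpredM ?opPV_Diffbar // rpred_prod // => i _.
by rewrite rpredM ?opPV_Diffbar // sub_Diff_Diffbar.
Qed.

End DiffBar.

Section RhoEps.
Variable k : fieldType.

Local Notation F := {fraction {poly k}}.
Local Notation eps := ('X%:F : F).

(* [<< c *g m >>] is c x^(eps + m).                                           *)
Definition eps_space := {malg F[int]}.
HB.instance Definition _ := GRing.Lmodule.on eps_space.

Definition xeps (m : int) : eps_space := << 1 *g m >>.

(* x^j f(x d/dx) sends x^(eps + m) to f(eps + m) x^(eps + m + j).             *)
Definition rho_eps (a : diffop k) (v : eps_space) : eps_space :=
  \sum_(j <- msupp a) \sum_(m <- msupp v)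
    << v@_m * frac_shift m a@_j *g m + j >>.

Lemma rho_epsE a v : rho_eps a v = dmul a v.
Proof.
apply: eq_bigr => j _; apply: eq_bigr => m _.
by rewrite mulrC addrC.
Qed.

Lemma rho_epsDl a b v : rho_eps (a + b) v = rho_eps a v + rho_eps b v.
Proof. by rewrite !rho_epsE dmulDl. Qed.

Lemma rho_epsDr a u v : rho_eps a (u + v) = rho_eps a u + rho_eps a v.
Proof. by rewrite !rho_epsE dmulDr. Qed.

Lemma rho_eps1 v : rho_eps 1 v = v.
Proof. by rewrite rho_epsE dmul1l. Qed.

Lemma rho_epsM a b v : rho_eps (a * b) v = rho_eps a (rho_eps b v).
Proof. by rewrite !rho_epsE dmulA. Qed.

Lemma scale_xeps (c : F) m : c *: xeps m = << c *g m >>.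
Proof. by apply/malgP => i; rewrite mcoeffZ !mcoeffU mulrnAr mulr1. Qed.

Lemma scaleU (c u : F) m : c *: (<< u *g m >> : eps_space) = << c * u *g m >>.
Proof. by apply/malgP => i; rewrite mcoeffZ !mcoeffU mulrnAr. Qed.

Lemma rho_epsZ a c v : rho_eps a (c *: v) = c *: rho_eps a v.
Proof.
rewrite !rho_epsE; elim/diffop_ind: a => [|a b ha hb|u i].
- by rewrite !dmul0l scaler0.
- by rewrite !dmulDl ha hb scalerDr.
elim/diffop_ind: v => [|v w hv hw|w j].
- by rewrite scaler0 dmul0r scaler0.
- have -> : dmul << u *g i >> (v + w) = dmul << u *g i >> v + dmul << u *g i >> w.
    exact: dmulDr.
  rewrite [RHS]scalerDr -hv -hw [c *: (v + w)]scalerDr; exact: dmulDr.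
by rewrite scaleU !dmulUU scaleU mulrCA.
Qed.

Lemma rho_eps_c c v : rho_eps (cop c) v = c%:P%:F *: v.
Proof.
rewrite rho_epsE; elim/diffop_ind: v => [|v w hv hw|w j].
- by rewrite dmul0r scaler0.
- by rewrite dmulDr hv hw scalerDr.
by rewrite dmulUU frac_shift_tofrac comp_polyC add0r scaleU.
Qed.

Lemma rho_eps_x m : rho_eps (xop k) (xeps m) = xeps (m + 1).
Proof. by rewrite rho_epsE dmulUU rmorph1 mulr1 addrC. Qed.

Lemma rho_eps_d m : rho_eps (dop k) (xeps m) = (eps + m%:~R) *: xeps (m - 1).
Proof.
rewrite rho_epsE dmulUU frac_shift_tofrac comp_polyX mulr1 scale_xeps addrC.
by rewrite tofracD !rmorph_int.
Qed.

End RhoEps.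

Section TEps.
Variable K : fieldType.

Local Notation F := {fraction {poly K}}.
Local Notation eps := ('X%:F : F).

Definition is_T_eps (T : F -> F) : Prop :=
  [/\ forall (c : K) (f g : F), T (c%:P%:F * f + g) = c%:P%:F * T f + T g,
      forall i : nat, T (eps ^+ i) = 0
    & forall (c : K) (j : nat), (0 < j)%N ->
        T ((eps - c%:P%:F) ^- j) = eps ^- j].

End TEps.

Section RhoP.
Variables (k : fieldType) (R : subringClosed k) (n : nat) (r : 'I_n -> rat).
Variables (p : nat) (I : idealr (subring_type R)).

(* I is the ideal (p); an [idealr] is proper, so this includes R/(p) <> 0.    *)
Definition is_pideal : Prop :=
  forall a : subring_type R, a \in I <-> exists b, a = p%:R * b.

Local Notation B := {ideal_quot I}.

(* R/(p)(xi, eta), with xi the inner and eta the outer variable; R/(p) need   *)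
(* not be a domain, whence the total ring of fractions.                       *)
Definition fun_ring := total_fraction {poly {poly B}}.
HB.instance Definition _ := GRing.ComUnitRing.on fun_ring.

Definition scal (b : B) : fun_ring := to_total_fraction b%:P%:P.
Definition xi_elt : fun_ring := to_total_fraction 'X%:P.
Definition eta_elt : fun_ring := to_total_fraction 'X.

(* Matrices, acting on columns, of the operators x + xi and d/dx + eta on     *)
(* K[x]/(x^p) in the basis 1, x, ..., x^(p-1).                                *)
Definition mx_x : 'M[fun_ring]_p :=
  \matrix_(i < p, j < p) (('X + xi_elt%:P) * 'X^j)`_i.
Definition mx_d : 'M[fun_ring]_p :=
  \matrix_(i < p, j < p) (('X^j)^`() + eta_elt *: 'X^j)`_i.

(* A ring morphism is determined on Diffbar by its values on R, x and d/dx.   *)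
Definition is_rho_p (rho : {rmorphism Diffbar R r -> 'M[fun_ring]_p}) : Prop :=
  forall u : Diffbar R r,
  [/\ forall c : subring_type R,
        val u = cop (val c) -> rho u = (scal (\pi_B c))%:M,
      val u = xop k -> rho u = mx_x
    & val u = dop k -> rho u = mx_d].

(* b is the reduction mod p of z in R[1/m]; b is unique if p does not divide m *)
Definition reduces_to (m : nat) (z : k) (b : B) : Prop :=
  exists (e : nat) (a : subring_type R),
    val a = z * m%:R ^+ e /\ \pi_B a = b * m%:R ^+ e.

End RhoP.

(* Main.v *)
Require Import Defs.
From HB Require Import structures.
From mathcomp Require Import all_boot all_order all_algebra finfield.
From mathcomp Require Import generic_quotient ring_quotient fraction.
From mathcomp Require Import finmap monalg boolp ring.

Set Implicit Arguments.
Unset Strict Implicit.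
Unset Printing Implicit Defensive.

Import GRing.Theory.
Local Open Scope ring_scope.

(* Write X, D for the matrices of x and d/dx and Theta = X D, so [D, X] = 1.
   In characteristic p, X^p D^p = Theta (Theta - 1) ... (Theta - p + 1)
   = Theta^p - Theta, which is the scalar s = xi^p eta^p; hence Theta and all its
   conjugates Theta - l are invertible and the representation extends to
   fractions with denominators among the t - r_i + m.  Since X^j shifts Theta
   by j, tr X^j f(Theta) = 0 when p does not divide j, so only the coefficient
   f_0 of A contributes to the trace for large p.  Expand f_0 into partial
   fractions.  Conjugation by X moves every pole, which is an integer mod p, to 0.
   Conjugation invariance kills tr Theta^i for i < p - 1, a commutator argument
   gives tr Theta^(p-1) = tr X^(p-1) D^(p-1) = (p - 1)! = -1, and then
   Theta^p - Theta = s yields tr Theta^-j = (-s)^-j for 0 < j <= p, which is the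
   value at eps = -s of T_eps applied to (eps - c)^-j. *)

(** * Arithmetic in rings of characteristic p *)

Lemma prime_inv_mod (p m : nat) : prime p -> ~~ (p %| m)%N ->
  exists w, (w * m = 1 %[mod p])%N.
Proof.
move=> p_pr pNm; have m_gt0 : (0 < m)%N by case: m pNm; rewrite ?dvdn0.
case: (egcdnP p m_gt0) => km kn Em _; exists km.
have /eqP gcd1 : coprime m p by rewrite coprime_sym prime_coprime.
by rewrite Em gcd1 modnMDl.
Qed.

Section PrimeCharacteristic.
Variables (K : nzRingType) (p : nat).
Hypotheses (p_pr : prime p) (pK : p%:R = 0 :> K).

Lemma natr_eqmod a b : (a = b %[mod p])%N -> a%:R = b%:R :> K.
Proof.
move=> eq_ab; rewrite (divn_eq a p) (divn_eq b p) eq_ab !natrD !natrM pK.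
by rewrite !mulr0.
Qed.

Lemma natr_inv m : ~~ (p %| m)%N -> exists w, w%:R * m%:R = 1 :> K.
Proof.
by case/(prime_inv_mod p_pr)=> w Ew; exists w; rewrite -natrM (natr_eqmod Ew).
Qed.

Lemma intr_natr (z : int) : exists l : nat, z%:~R = l%:R :> K.
Proof.
case: z => m; first by exists m.
(* As p - 1 equals -1 in [K], this witness represents -(m + 1). *)
exists (m.+1 * p.-1)%N; rewrite NegzE mulrNz natrM -[p.-1]subn1.
by rewrite natrB ?prime_gt0 // pK sub0r mulrN1.
Qed.

Lemma exprDp_comm (a b : K) : a * b = b * a -> (a + b) ^+ p = a ^+ p + b ^+ p.
Proof.
case: p p_pr pK => // q q_pr qK cab.
rewrite (exprDn_comm _ cab) big_ord_recl big_ord_recr /= subn0 mulr1.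
rewrite /bump add1n subnn mul1r bin0 binn !mulr1n big1 ?add0r // => i _.
have /dvdnP[c ->] : (q.+1 %| 'C(q.+1, 1 + i))%N.
  by rewrite prime_dvd_bin //= add1n ltnS ltn_ord.
by rewrite -mulr_natr natrM qK !mulr0.
Qed.

End PrimeCharacteristic.

(** The factorisation of t^p - t over the field with p elements, carried to [K] by the structure
    morphism of [K] as an algebra over that field. *)
Lemma prod_XsubC_prime (K : comNzRingType) (p : nat) : prime p ->
  p%:R = 0 :> K -> \prod_(i < p) ('X - i%:R%:P) = 'X^p - 'X :> {poly K}.
Proof.
move=> p_pr pK; have chK : p \in [pchar K] by rewrite inE p_pr pK eqxx.
pose Kp := pPrimeCharType chK.
suff: \prod_(i < p) ('X - i%:R%:P) = 'X^p - 'X :> {poly Kp} by [].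
pose fr : {rmorphism 'F_p -> Kp} := in_alg Kp.
have frE x : map_poly fr ('X - x%:P) = 'X - (x : nat)%:R%:P.
  rewrite rmorphB /= map_polyX map_polyC; congr (_ - _%:P).
  by rewrite -[in LHS](natr_Zp x); exact: (rmorph_nat fr).
have /(congr1 (map_poly fr)) := finField_genPoly 'F_p.
rewrite rmorphB /= map_polyXn map_polyX card_Fp // => ->.
rewrite rmorph_prod (eq_bigr _ (fun x _ => frE x)) /=.
rewrite -(big_mkord predT (fun i => 'X - i%:R%:P)).
by rewrite -(big_mkord predT (fun i => 'X - i%:R%:P)) Fp_cast.
Qed.
(** * Matrices satisfying the Weyl relation in characteristic p *)

Section WeylPair.
Variables (K : comUnitRingType) (n : nat).
Local Notation p := n.+1.
Hypotheses (p_pr : prime p) (pK : p%:R = 0 :> K).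
Variables (X D : 'M[K]_p) (s : K).
Hypotheses (X_unit : X \is a GRing.unit) (s_unit : s \is a GRing.unit).
Hypothesis commDX : D * X = X * D + 1.
Hypothesis XpDp : X ^+ p * D ^+ p = s%:M.
Hypothesis trXD : \tr (X ^+ n * D ^+ n) = -1.
Local Notation Theta := (X * D).

(** By D X = X D + 1, moving one factor X to the left past Theta adds 1 to Theta. *)
Lemma Theta_exprX (j : nat) : Theta * X ^+ j = X ^+ j * (Theta + j%:R).
Proof.
elim: j => [|j IH]; first by rewrite mulr1 addr0 mul1r.
rewrite exprSr mulrA IH -!mulrA; congr (_ * _).
by rewrite mulrDl -mulrA commDX !mulrDr mulr1 -addrA -(commr_nat X) -nat1r mulrDr mulr1.
Qed.

Lemma Theta_exprzX (j : int) : Theta * X ^ j = X ^ j * (Theta + j%:~R).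
Proof.
case: j => j; first exact: Theta_exprX.
have Xj_unit := unitrX j.+1 X_unit.
(* Multiplied by X^(j+1) on both sides, the claim becomes the one for a positive exponent. *)
rewrite NegzE mulrNz -exprnN; apply: (mulIr Xj_unit); apply: (mulrI Xj_unit).
rewrite mulrVK // !mulrA mulrV // mul1r mulrBl Theta_exprX.
by rewrite -pmulrn mulrDr -(commr_nat (X ^+ j.+1)) addrK mulrA.
Qed.

(** X^(j+1) D^(j+1) = X^j Theta D^j, and Theta becomes Theta - j when it is moved to the left of
    X^j. *)
Lemma exprX_exprD (j : nat) :
  X ^+ j * D ^+ j = horner_mx Theta (\prod_(i < j) ('X - i%:R%:P)).
Proof.
elim: j => [|j IH]; first by rewrite big_ord0 rmorph1 mulr1.
rewrite big_ord_recr /= mulrC rmorphM /= -IH rmorphB /= horner_mx_X horner_mx_C.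
rewrite mulrA (_ : j%:R%:M = j%:R) ?rmorph_nat // mulrBl Theta_exprX.
by rewrite mulrDr -(commr_nat (X ^+ j)) addrK exprSr exprS !mulrA.
Qed.

(* In characteristic p the falling factorial t(t-1)...(t-p+1) is t^p - t. *)
Lemma Theta_ArtinSchreier : Theta ^+ p - Theta = s%:M.
Proof.
rewrite -XpDp exprX_exprD prod_XsubC_prime // rmorphB /= rmorphXn /=.
by rewrite horner_mx_X.
Qed.

(** Theta and Theta^(p-1) - 1 commute, and their product is the invertible scalar s. *)
Lemma Theta_unit : Theta \is a GRing.unit.
Proof.
have E : Theta * (Theta ^+ n - 1) = s%:M.
  by rewrite mulrBr mulr1 -exprS Theta_ArtinSchreier.
have: Theta * (Theta ^+ n - 1) \is a GRing.unit.
  by rewrite E -[_ \is a _]/(_ \in unitmx) unitmxE det_scalar unitrX.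
have cTh : GRing.comm Theta (Theta ^+ n - 1).
  by apply: commrB; [exact: commrX | exact: commr1].
by rewrite unitrM_comm // => /andP[].
Qed.

Lemma mxtrace_conj (U A : 'M[K]_p) : U \is a GRing.unit ->
  \tr (U * A * U^-1) = \tr A.
Proof. by move=> uU; rewrite mxtrace_mulC [_ *m _]mulrA mulVr // mul1r. Qed.

Lemma expr_conj (U A : 'M[K]_p) (i : nat) : U \is a GRing.unit ->
  (U * A * U^-1) ^+ i = U * A ^+ i * U^-1.
Proof.
move=> uU; elim: i => [|i IH]; first by rewrite !expr0 mulr1 mulrV.
by rewrite exprS IH !mulrA mulrVK // -[U * A * _]mulrA -exprS.
Qed.

Lemma Theta_subn (l : nat) : Theta - l%:R = X ^+ l * Theta * (X ^+ l)^-1.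
Proof.
have uXl := unitrX l X_unit; apply: (mulIr uXl); rewrite mulrVK //.
by rewrite mulrBl Theta_exprX mulrDr -(commr_nat (X ^+ l)) addrK.
Qed.

Lemma Theta_subn_unit (l : nat) : Theta - l%:R \is a GRing.unit.
Proof.
have uXl := unitrX l X_unit.
by rewrite Theta_subn unitrMl ?unitrV // unitrMr // Theta_unit.
Qed.

(** Conjugation by X^l moves the pole l to 0; this is the matrix counterpart of T_eps sending (eps -
    c)^-j to eps^-j. *)
Lemma mxtrace_Theta_subnV (l i : nat) :
  \tr ((Theta - l%:R)^-1 ^+ i) = \tr (Theta^-1 ^+ i).
Proof.
have uXl := unitrX l X_unit; have uT := Theta_unit.
have -> : (Theta - l%:R)^-1 = X ^+ l * Theta^-1 * (X ^+ l)^-1.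
  apply: (mulrI (Theta_subn_unit l)); rewrite mulrV ?Theta_subn_unit //.
  rewrite Theta_subn; move: Theta uT => Th uTh.
  by rewrite !mulrA mulrVK // mulrK // mulrV.
by rewrite expr_conj // mxtrace_conj.
Qed.

(** Theta + 1 is conjugate to Theta, so their (i+1)-st powers have the same trace. In the binomial
    expansion the powers below i have trace 0 by induction, which leaves (i+1) tr Theta^i = 0 with i
    + 1 < p invertible. *)
Lemma mxtrace_Theta_exp (i : nat) : (i < n)%N -> \tr (Theta ^+ i) = 0.
Proof.
elim/ltn_ind: i => i IH lt_in.
have: \tr ((Theta + 1) ^+ i.+1) = \tr (Theta ^+ i.+1).
  have -> : Theta + 1 = X^-1 * Theta * X^-1^-1.
    by rewrite invrK -mulrA (Theta_exprX 1) mulKr.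
  by rewrite expr_conj ?unitrV // mxtrace_conj ?unitrV.
rewrite exprD1n !big_ord_recr /= binn mulr1n binSn.
rewrite !raddfD /= [X in X + _ + _]raddf_sum /= big1 ?add0r => [|l _]; last first.
  by rewrite raddfMn /= IH ?mul0rn // (ltn_trans _ lt_in).
move/(canRL (addrK _)); rewrite subrr raddfMn /= -mulr_natr => Eti.
have [|w wE] := natr_inv p_pr pK (m := i.+1); first by rewrite gtnNdvd.
by rewrite -[LHS]mulr1 -wE [w%:R * _]mulrC mulrA Eti mul0r.
Qed.

Lemma mxtrace_horner_Theta (q : {poly K}) : (size q <= n)%N ->
  \tr (horner_mx Theta q) = 0.
Proof.
move=> le_qn; rewrite -[q]coefK poly_def !raddf_sum big1 //= => i _.
rewrite linearZ rmorphXn /= horner_mx_X linearZ /= mxtrace_Theta_exp ?mulr0 //.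
exact: leq_trans (ltn_ord i) le_qn.
Qed.

(** Theta^(p-1) and X^(p-1) D^(p-1) are both monic of degree p - 1 in Theta, so their difference has
    lower degree and trace 0. *)
Lemma mxtrace_Theta_expn : \tr (Theta ^+ n) = -1.
Proof.
pose P : {poly K} := \prod_(i < n) ('X - i%:R%:P).
have size_P : size P = p.
  by rewrite size_prod_XsubC /index_enum -enumT size_enum_ord.
have P_monic : P \is monic by apply: monic_prod_XsubC.
have : (size ('X^n - P)%R <= n)%N.
  apply/leq_sizeP => j; rewrite leq_eqVlt => /orP[/eqP<-|lt_nj].
    rewrite coefB coefXn eqxx; move/monicP: P_monic.
    by rewrite lead_coefE size_P => ->; rewrite subrr.
  by rewrite coefB coefXn gtn_eqF // nth_default ?subrr // size_P.
move/mxtrace_horner_Theta; rewrite rmorphB /= -exprX_exprD rmorphXn /= horner_mx_X.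
by rewrite raddfB /= trXD => /eqP; rewrite subr_eq0 => /eqP.
Qed.

(* Multiplying Theta^p - Theta = s by Theta^-(j+1) and taking traces gives
   the recursion tr Theta^-(j+1) = - s^-1 tr Theta^-j. *)
Lemma mxtrace_ThetaV_exp (j : nat) : (j <= n)%N ->
  \tr (Theta^-1 ^+ j.+1) = (- s)^-1 ^+ j.+1.
Proof.
have uT := Theta_unit.
have rec i : (i <= n)%N ->
    s * \tr (Theta^-1 ^+ i.+1) = \tr (Theta ^+ (n - i)) - \tr (Theta^-1 ^+ i).
  move=> le_in; rewrite -linearZ -raddfB /=; congr (\tr _).
  rewrite -mul_scalar_mx -Theta_ArtinSchreier -[_ *m _]/(_ * _) mulrBl.
  congr (_ - _); last by rewrite exprS mulrA mulrV // mul1r.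
  have -> : Theta ^+ p = Theta ^+ (n - i) * Theta ^+ i.+1.
    by rewrite -exprD addnS subnK.
  by rewrite exprVn mulrK // unitrX.
have sNV : s * (- s)^-1 = -1 by rewrite invrN mulrN mulrV.
elim: j => [|j IH] le_jn.
  (* The recursion starts differently: here tr Theta^(p-1) = -1 contributes, while tr 1 = p = 0. *)
  have := rec _ (leq0n n).
  rewrite subn0 mxtrace_Theta_expn !expr0 mxtrace1 pK subr0 expr1 => E.
  by apply: (mulrI s_unit); rewrite E sNV.
apply: (mulrI s_unit); rewrite rec // mxtrace_Theta_exp; last first.
  by rewrite subnSK // leq_subr.
rewrite IH ?(ltnW le_jn) // sub0r [RHS]mulrA sNV.
by rewrite mulN1r.
Qed.

End WeylPair.

(** * Traces of Weyl monomials *)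

Section TraceWeyl.
Variables (K : comNzRingType) (n : nat).
Local Notation p := n.+1.
Hypotheses (p_pr : prime p) (pK : p%:R = 0 :> K).

Lemma natr_torsion_free (m : nat) (x : K) : (0 < m <= n)%N -> m%:R * x = 0 -> x = 0.
Proof.
case/andP=> m_gt0 le_mn mx0; have [|w wE] := natr_inv p_pr pK (m := m).
  by rewrite gtnNdvd.
by rewrite -[x]mul1r -wE -mulrA mx0 mulr0.
Qed.

(* m X^u D^v is a commutator for m = v + 1, and for m = u + 1. *)
Lemma mxtrace_Weyl_lt (X D : 'M[K]_p) (u v : nat) : D * X = X * D + 1 ->
  (u < n)%N || (v < n)%N -> \tr (X ^+ u * D ^+ v) = 0.
Proof.
move=> DX /orP[lt_un | lt_vn].
  have DXexp w : D * X ^+ w.+1 = X ^+ w.+1 * D + X ^+ w *+ w.+1.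
    elim: w => [|w IH]; first by rewrite expr1.
    rewrite [in LHS]exprSr mulrA IH mulrDl -mulrA DX mulrDr mulr1 mulrnAl.
    by rewrite mulrA -!exprSr -addrA -mulrS.
  apply: (@natr_torsion_free u.+1); first by [].
  have: \tr (D * (X ^+ u.+1 * D ^+ v)) = \tr (X ^+ u.+1 * D ^+ v * D).
    exact: mxtrace_mulC.
  rewrite mulrA DXexp mulrDl raddfD /= -!mulrA -exprS -exprSr.
  move/(canRL (addKr _)); rewrite addNr mulrnAl raddfMn /= => <-.
  by rewrite mulr_natl.
have DexpX w : D ^+ w.+1 * X = X * D ^+ w.+1 + D ^+ w *+ w.+1.
  elim: w => [|w IH]; first by rewrite expr1.
  rewrite [in LHS]exprS -mulrA IH mulrDr mulrA DX mulrDl mul1r mulrnAr.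
  by rewrite -exprS -mulrA -exprS -addrA -mulrS.
apply: (@natr_torsion_free v.+1); first by [].
have: \tr (X ^+ u * D ^+ v.+1 * X) = \tr (X * (X ^+ u * D ^+ v.+1)).
  exact: mxtrace_mulC.
rewrite -mulrA DexpX mulrDr raddfD /= !mulrA -exprS -exprSr.
move/(canRL (addKr _)); rewrite addNr mulrnAr raddfMn /= => <-.
by rewrite mulr_natl.
Qed.

(** In the binomial expansion every power of A below n has trace 0 against M. This removes the
    scalars xi and eta from the trace of X^n D^n. *)
Lemma mxtrace_translate_exp (M A : 'M[K]_p) (b : K) :
    (forall v, (v < n)%N -> \tr (M * A ^+ v) = 0) ->
  \tr (M * (A + b%:M) ^+ n) = \tr (M * A ^+ n).
Proof.
move=> trMA; have cAb : GRing.comm A b%:M by exact: scalar_mxC.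
rewrite (exprDn_comm _ cAb) big_ord_recl subn0 expr0 mulr1 bin0 mulr1n mulrDr.
rewrite raddfD /= mulr_sumr raddf_sum /= big1 ?addr0 // => i _.
rewrite mulrnAr -(rmorphXn (@scalar_mx K p)) /= mulrA raddfMn /=.
rewrite -[_ * _%:M]/(_ *m _%:M) mul_mx_scalar linearZ /= trMA ?mulr0 ?mul0rn //.
by rewrite ltn_subrL /= (leq_ltn_trans _ (ltn_ord i)).
Qed.

End TraceWeyl.

(** * The operators x + a and d/dx + b on K[x]/(x^p) *)

Section TruncatedPolynomials.
Variables (K : comNzRingType) (n : nat).
Local Notation p := n.+1.

Definition xshift_mx (a : K) : 'M[K]_p :=
  \matrix_(i < p, j < p) (('X + a%:P) * 'X^j)`_i.
Definition dshift_mx (b : K) : 'M[K]_p :=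
  \matrix_(i < p, j < p) (('X^j)^`() + b *: 'X^j)`_i.

(** Computes products with a matrix having one nonzero entry per row or column; the factor [(m < p)]
    records the truncation modulo x^p. *)
Lemma sum_ord_pick (m : nat) (F : nat -> K) :
  \sum_(l < p) (m == l)%:R * F l = (m < p)%:R * F m.
Proof.
case: ltnP => [lt_mp | le_pm].
  rewrite (bigD1 (Ordinal lt_mp)) //= eqxx big1 ?addr0 // => l lNm.
  by rewrite eq_sym -[m]/(val (Ordinal lt_mp)) (inj_eq val_inj) (negPf lNm) mul0r.
by rewrite mul0r big1 // => l _; rewrite gtn_eqF ?mul0r // (leq_trans (ltn_ord l)).
Qed.

Lemma xshift_mx0_exp (u : nat) :
  xshift_mx 0 ^+ u = \matrix_(i < p, j < p) (i == j + u :> nat)%N%:R.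
Proof.
elim: u => [|u IH]; first by apply/matrixP => i j; rewrite !mxE addn0.
rewrite exprSr IH; apply/matrixP => i j; rewrite !mxE.
under eq_bigr => l _ do
  rewrite !mxE addr0 -exprS coefXn mulrC [(l : nat) == _]eq_sym.
rewrite (sum_ord_pick j.+1 (fun l => (i == l + u :> nat)%N%:R)) addSnnS.
case: ltnP => [_|le_pj]; first by rewrite mul1r.
rewrite mul0r ltn_eqF // -addSnnS.
exact: leq_trans (ltn_ord i) (leq_trans le_pj (leq_addr _ _)).
Qed.

Lemma dshift_mx0_exp (v : nat) :
  dshift_mx 0 ^+ v = \matrix_(i < p, j < p) ((i + v == j)%N%:R * (j ^_ v)%:R).
Proof.
elim: v => [|v IH]; first by apply/matrixP => i j; rewrite !mxE addn0 mulr1.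
rewrite exprS IH; apply/matrixP => i j; rewrite !mxE.
(* Row i of the matrix of d/dx has its only nonzero entry, i + 1, in column i + 1. *)
transitivity (\sum_(l < p) (i.+1 == l)%:R *
    (i.+1%:R * (i.+1 + v == j)%N%:R * (j ^_ v)%:R) : K).
  apply: eq_bigr => l _; rewrite !mxE scale0r addr0 derivXn coefMn coefXn.
  case: (eqVneq i.+1 l) => [<-|iNl]; first by rewrite /= eqxx mul1r mulrA.
  case: (l : nat) iNl => [|l'] iNl; first by rewrite mulr0n !mul0r.
  by rewrite /= -[i == l' :> nat]eqSS (negPf iNl) mul0rn !mul0r.
pose c : K := i.+1%:R * (i.+1 + v == j)%N%:R * (j ^_ v)%:R.
rewrite (sum_ord_pick i.+1 (fun=> c)) {}/c addSnnS ffactnSr natrM.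
case: ltnP => [_|le_pi].
  case: eqVneq => [<-|_]; last by rewrite mulr0 !mul0r mulr0.
  by rewrite !mul1r mulr1 -addSnnS addnK mulrC.
rewrite mul0r gtn_eqF ?mul0r // -addSnnS.
exact: leq_trans (ltn_ord j) (leq_trans le_pi (leq_addr _ _)).
Qed.

Lemma xshift_mxE a : xshift_mx a = xshift_mx 0 + a%:M.
Proof.
apply/matrixP => i j; rewrite !mxE addr0 mulrDl coefD coefCM coefXn.
by rewrite mulr_natr.
Qed.

Lemma dshift_mxE b : dshift_mx b = dshift_mx 0 + b%:M.
Proof.
apply/matrixP => i j; rewrite !mxE scale0r addr0 coefD coefZ coefXn.
by rewrite mulr_natr.
Qed.

Hypotheses (p_pr : prime p) (pK : p%:R = 0 :> K).

(** Truncation respects the Weyl relation because the derivative p x^(p-1) of x^p vanishes in [K].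
    The scalars a and b are central, so the case a = b = 0 suffices. *)
Lemma dshift_xshift_mx a b :
  dshift_mx b * xshift_mx a = xshift_mx a * dshift_mx b + 1.
Proof.
have base : dshift_mx 0 * xshift_mx 0 = xshift_mx 0 * dshift_mx 0 + 1.
  rewrite -[dshift_mx 0]expr1 -[xshift_mx 0]expr1 xshift_mx0_exp dshift_mx0_exp.
  apply/matrixP => i j; rewrite !mxE.
  under eq_bigr => l _ do rewrite !mxE addn1 addn1 ffactn1 -mulrA.
  rewrite (sum_ord_pick i.+1 (fun l => l%:R * (l == j.+1)%:R)) eqSS.
  (* In the last row the truncated term carries the coefficient p, which is 0. *)
  transitivity (i.+1%:R * (i == j :> nat)%:R : K).
    case: ltnP => [_|le_pi]; first by rewrite mul1r.
    have -> : i.+1 = p by apply/eqP; rewrite eqn_leq le_pi ltn_ord.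
    by rewrite pK !mul0r.
  under [X in X + _]eq_bigr => l _ do rewrite !mxE !addn1 ffactn1.
  have -> : \sum_(l < p) (i == l.+1 :> nat)%:R * ((l.+1 == j)%:R * j%:R) =
      i%:R * (i == j :> nat)%:R :> K.
    case: i => -[|i] lt_ip /=.
      by rewrite mul0r big1 // => l _; rewrite mul0r.
    rewrite (sum_ord_pick i (fun l => (l.+1 == j)%:R * j%:R)) ltnW // mul1r.
    by rewrite mulrC; case: eqVneq => [->|]; rewrite ?mulr0.
  by rewrite -natr1 mulrDl mul1r.
have scC c A : A * c%:M = c%:M * A :> 'M[K]_p by exact: scalar_mxC.
rewrite xshift_mxE dshift_mxE mulrDl !mulrDr base !mulrDl.
rewrite (scC a (dshift_mx 0)) (scC b (xshift_mx 0)) (scC a b%:M).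
by rewrite -!addrA; congr (_ + _); rewrite addrC -!addrA addrCA.
Qed.

(** Frobenius applied to the commuting summands x and a; x^p = 0 after truncation. *)
Lemma xshift_mx_expp a : xshift_mx a ^+ p = (a ^+ p)%:M.
Proof.
have pM : p%:R = 0 :> 'M[K]_p by rewrite -(rmorph_nat (@scalar_mx K p)) pK raddf0.
rewrite xshift_mxE (exprDp_comm p_pr pM); last exact: scalar_mxC.
rewrite xshift_mx0_exp -(rmorphXn (@scalar_mx K p)) /= -[RHS]add0r; congr (_ + _).
apply/matrixP => i j; rewrite !mxE ltn_eqF // (leq_trans (ltn_ord i)) //.
exact: leq_addl.
Qed.

Lemma dshift_mx_expp b : dshift_mx b ^+ p = (b ^+ p)%:M.
Proof.
have pM : p%:R = 0 :> 'M[K]_p by rewrite -(rmorph_nat (@scalar_mx K p)) pK raddf0.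
rewrite dshift_mxE (exprDp_comm p_pr pM); last exact: scalar_mxC.
rewrite dshift_mx0_exp -(rmorphXn (@scalar_mx K p)) /= -[RHS]add0r; congr (_ + _).
apply/matrixP => i j; rewrite !mxE gtn_eqF ?mul0r // (leq_trans (ltn_ord j)) //.
exact: leq_addl.
Qed.

(** The shifts b and a are removed in turn. At a = b = 0, D^(p-1) X^(p-1) kills every x^j with j > 0
    and sends 1 to (p-1)!, which is -1 by Wilson's theorem. *)
Lemma mxtrace_xshift_dshift a b :
  \tr (xshift_mx a ^+ n * dshift_mx b ^+ n) = -1.
Proof.
rewrite (dshift_mxE b) mxtrace_translate_exp; last first.
  by move=> v lt_vn; rewrite (mxtrace_Weyl_lt p_pr pK) ?dshift_xshift_mx ?lt_vn ?orbT.
rewrite [\tr _]mxtrace_mulC xshift_mxE mxtrace_translate_exp; last first.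
  move=> u lt_un; rewrite [\tr _]mxtrace_mulC.
  by rewrite (mxtrace_Weyl_lt p_pr pK) ?dshift_xshift_mx ?lt_un.
rewrite xshift_mx0_exp dshift_mx0_exp /mxtrace.
rewrite big_ord_recl big1 ?addr0 => [|i _]; last first.
  rewrite mxE big1 // => l _; rewrite !mxE gtn_eqF ?mul0r //.
  by rewrite lift0 addSn ltnS (leq_trans _ (leq_addl _ _)) // -ltnS.
rewrite mxE big_ord_recr big1 ?add0r /= => [|i _]; last first.
  by rewrite !mxE gtn_eqF ?mul0r //= ltn_ord.
rewrite !mxE !add0n !eqxx /= mul1r mulr1 ffactnn.
have n_gt0 : (1 < p)%N by exact: prime_gt1.
have : (p %| n`!.+1)%N by rewrite -Wilson.
case/dvdnP => c /(congr1 (fun m => m%:R : K)); rewrite natrM pK mulr0 -natr1.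
by move/eqP; rewrite addr_eq0 => /eqP; rewrite add0r.
Qed.

End TruncatedPolynomials.

(** * Fractions with prescribed poles *)

Section Localization.
Variables (A : comNzRingType) (F : fieldType) (i : {rmorphism A -> F}).
Variable den : A -> Prop.
Hypotheses (i_inj : injective i) (den1 : den 1).
Hypothesis denM : forall d e, den d -> den e -> den (d * e).
Hypothesis den_neq0 : forall d, den d -> i d != 0.

(** The localisation of A at [den], realised inside the field [F]. Numerator and denominator form a
    pair so that one choice extracts both. *)
Definition loc (f : F) : Prop := exists ad : A * A, den ad.2 /\ f = i ad.1 / i ad.2.

Lemma loc_frac a d : den d -> loc (i a / i d).
Proof. by move=> dd; exists (a, d). Qed.

Lemma loc_img a : loc (i a).
Proof. by rewrite -[i a]divr1 -(rmorph1 i); apply: loc_frac. Qed.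

Lemma loc_same_den f g : loc f -> loc g ->
  exists a b d, [/\ den d, f = i a / i d & g = i b / i d].
Proof.
case=> -[a d] /= [dd ->] [[b e] /= [de ->]]; exists (a * e), (b * d), (d * e).
have [d0 e0] := (den_neq0 dd, den_neq0 de).
split; first exact: denM; rewrite !rmorphM; first by rewrite -mulf_div divff ?mulr1.
by rewrite [i d * i e]mulrC -mulf_div divff ?mulr1.
Qed.

Lemma locB f g : loc f -> loc g -> loc (f - g).
Proof.
move=> lf lg; have [a [b [d [dd -> ->]]]] := loc_same_den lf lg.
by rewrite -mulrBl -rmorphB; apply: loc_frac.
Qed.

Lemma locD f g : loc f -> loc g -> loc (f + g).
Proof.
move=> lf lg; have [a [b [d [dd -> ->]]]] := loc_same_den lf lg.
by rewrite -mulrDl -rmorphD; apply: loc_frac.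
Qed.

Lemma locM f g : loc f -> loc g -> loc (f * g).
Proof.
case=> -[a d] /= [dd ->] [[b e] /= [de ->]].
by rewrite mulf_div -!rmorphM; apply/loc_frac/denM.
Qed.

Variables (E : unitRingType) (phi : {rmorphism A -> E}).
Hypothesis phi_unit : forall d, den d -> phi d \is a GRing.unit.

(** The extension of [phi] given by the universal property, computed on a chosen fraction; 0 is a
    default value outside [loc]. *)
Definition loc_ext (f : F) : E :=
  if pselect (loc f) is left h
  then let ad := projT1 (cid h) in phi ad.1 / phi ad.2 else 0.

(** Independence of the chosen fraction: two fractions cross-multiply in A, as [i] is injective, and
    images under [phi] commute even when E is not commutative. *)
Lemma loc_extE a d : den d -> loc_ext (i a / i d) = phi a / phi d.
Proof.
move=> dd; rewrite /loc_ext; case: pselect => [h|[]]; last exact: loc_frac.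
case: (cid h) => -[b e] /= [de /eqP]; rewrite eqr_div ?den_neq0 //.
rewrite -!rmorphM (inj_eq i_inj) => /eqP eq_ae.
have [ud ue] := (phi_unit dd, phi_unit de).
have cde : GRing.comm (phi d) (phi e) by rewrite /GRing.comm -!rmorphM mulrC.
apply: (mulIr ud); rewrite mulrVK // -mulrA -(commrV cde) mulrA -rmorphM -eq_ae.
by rewrite rmorphM mulrK.
Qed.

Lemma loc_ext_img a : loc_ext (i a) = phi a.
Proof. by rewrite -[i a]divr1 -(rmorph1 i) loc_extE // rmorph1 divr1. Qed.

Lemma loc_extD f g : loc f -> loc g -> loc_ext (f + g) = loc_ext f + loc_ext g.
Proof.
move=> lf lg; have [a [b [d [dd -> ->]]]] := loc_same_den lf lg.
by rewrite -mulrDl -rmorphD !loc_extE // rmorphD mulrDl.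
Qed.

Lemma loc_extM f g : loc f -> loc g -> loc_ext (f * g) = loc_ext f * loc_ext g.
Proof.
case=> -[a d] /= [dd ->] [[b e] /= [de ->]].
rewrite mulf_div -!rmorphM !loc_extE //; last exact: denM.
have [ud ue] := (phi_unit dd, phi_unit de).
rewrite [d * e]mulrC !rmorphM invrM // !mulrA; congr (_ * _).
rewrite -!mulrA; congr (_ * _); apply: commrV.
by rewrite /GRing.comm -!rmorphM mulrC.
Qed.

End Localization.

(** * Operators whose coefficients have prescribed poles *)

Section ThetaRing.
Variables (k : fieldType) (B : comNzRingType) (v : {rmorphism B -> k}).
Variables (J : Type) (c : J -> B) (sh : J -> int -> J).
Hypotheses (v_inj : injective v) (c_sh : forall x m, c (sh x m) = c x - m%:~R).

Local Notation F := {fraction {poly k}}.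

Definition polyF : {rmorphism {poly B} -> F} :=
  (@FracField.tofrac {poly k} \o map_poly v).

Lemma polyF_inj : injective polyF.
Proof.
move=> a b /= /eqP; rewrite tofrac_eq => /eqP /(map_inj_poly v_inj (rmorph0 v)).
exact.
Qed.

Lemma polyFC b : polyF b%:P = (v b)%:P%:F.
Proof. by rewrite /= map_polyC. Qed.

Lemma polyFX : polyF 'X = 'X%:F.
Proof. by rewrite /= map_polyX. Qed.

Definition theta_den (d : {poly B}) : Prop :=
  exists l : seq J, d = \prod_(x <- l) ('X - (c x)%:P).

(** The ring B[t, (t - c x)^-1 for all x in J], with t standing for x d/dx. *)
Definition theta_ring : F -> Prop := loc polyF theta_den.

Lemma theta_den1 : theta_den 1.
Proof. by exists [::]; rewrite big_nil. Qed.

Lemma theta_denM d e : theta_den d -> theta_den e -> theta_den (d * e).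
Proof. by case=> l -> [l' ->]; exists (l ++ l'); rewrite big_cat. Qed.

Lemma theta_den_pole x (e : nat) : theta_den (('X - (c x)%:P) ^+ e).
Proof. by exists (nseq e x); rewrite big_nseq -Monoid.iteropE. Qed.

Lemma theta_den_neq0 d : theta_den d -> polyF d != 0.
Proof.
case=> l ->; rewrite -(rmorph0 polyF) (inj_eq polyF_inj).
exact/monic_neq0/monic_prod_XsubC.
Qed.

(** The substitution of t + m for t moves the pole c x to c x - m, again a pole by [c_sh]. Hence the
    twist in the product of operators preserves [theta_ring]. *)
Lemma theta_den_shift d m : theta_den d -> theta_den (d \Po ('X + m%:~R%:P)).
Proof.
case=> l ->; exists (map (sh^~ m) l); rewrite big_map rmorph_prod /=.
apply: eq_bigr => x _.
by rewrite comp_polyB comp_polyX comp_polyC c_sh polyCB opprB addrA.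
Qed.

Lemma frac_shift_polyF m a d : theta_den d ->
  frac_shift m (polyF a / polyF d) =
  polyF (a \Po ('X + m%:~R%:P)) / polyF (d \Po ('X + m%:~R%:P)).
Proof.
move=> dd; rewrite /= frac_shiftE; last first.
  by have := theta_den_neq0 dd; rewrite /= tofrac_eq0.
have mapX (b : {poly B}) :
    map_poly v b \Po ('X + m%:~R%:P) = map_poly v (b \Po ('X + m%:~R%:P)).
  rewrite map_comp_poly rmorphD /= map_polyX map_polyC; congr (_ \Po (_ + _%:P)).
  exact/esym/(rmorph_int v).
by rewrite !mapX.
Qed.

Lemma theta_ring_shift f m : theta_ring f -> theta_ring (frac_shift m f).
Proof.
case=> -[a d] [/= dd ->]; rewrite frac_shift_polyF //.
exact/loc_frac/theta_den_shift.
Qed.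

Definition theta_diffop (a : diffop k) : Prop := forall j, theta_ring a@_j.

Lemma theta_ring_img a : theta_ring (polyF a).
Proof. by apply: loc_img; exact: theta_den1. Qed.

Lemma theta_ring0 : theta_ring 0.
Proof. by rewrite -(rmorph0 polyF); apply: theta_ring_img. Qed.

Lemma theta_ringD f g : theta_ring f -> theta_ring g -> theta_ring (f + g).
Proof. exact: (locD theta_denM theta_den_neq0). Qed.

Lemma theta_ringM f g : theta_ring f -> theta_ring g -> theta_ring (f * g).
Proof. exact: (locM theta_denM). Qed.

Lemma theta_diffopU u i : theta_ring u -> theta_diffop << u *g i >>.
Proof.
move=> Su j; rewrite mcoeffU; case: eqP => _; first by rewrite mulr1n.
by rewrite mulr0n; apply: theta_ring0.
Qed.

Lemma theta_diffop0 : theta_diffop 0.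
Proof. by move=> j; rewrite mcoeff0; apply: theta_ring0. Qed.

Lemma theta_diffopD a b : theta_diffop a -> theta_diffop b -> theta_diffop (a + b).
Proof. by move=> Sa Sb j; rewrite mcoeffD; apply: theta_ringD. Qed.

Lemma theta_diffopB a b : theta_diffop a -> theta_diffop b -> theta_diffop (a - b).
Proof.
move=> Sa Sb j; rewrite mcoeffB.
exact: (locB theta_denM theta_den_neq0 (Sa j) (Sb j)).
Qed.

(** The induction carries membership along, because the maps studied below are additive only on
    operators in [theta_diffop]. *)
Lemma theta_diffop_ind (Q : diffop k -> Prop) : Q 0 ->
    (forall a b, theta_diffop a -> theta_diffop b -> Q a -> Q b -> Q (a + b)) ->
    (forall u i, theta_ring u -> Q << u *g i >>) ->
  forall a, theta_diffop a -> Q a.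
Proof.
move=> Q0 QD QU a Sa; rewrite [a]monalgE.
suff [] : theta_diffop (\sum_(i <- msupp a) << a@_i *g i >>) /\
          Q (\sum_(i <- msupp a) << a@_i *g i >>) by [].
elim/big_ind: _ => [|b b' [Sb Qb] [Sb' Qb']|i _].
- by split; first exact: theta_diffop0.
- by split; [exact: theta_diffopD | exact: QD].
by split; [exact/theta_diffopU | exact: QU].
Qed.

Lemma theta_diffopM a b : theta_diffop a -> theta_diffop b -> theta_diffop (a * b).
Proof.
move=> Sa Sb; elim/theta_diffop_ind: a / Sa => [|a a' _ _ Ha Ha'|u i Su].
- by rewrite mul0r; apply: theta_diffop0.
- by rewrite mulrDl; apply: theta_diffopD.
elim/theta_diffop_ind: b / Sb => [|b b' _ _ Hb Hb'|w j Sw].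
- by rewrite mulr0; apply: theta_diffop0.
- by rewrite mulrDr; apply: theta_diffopD.
by rewrite diffopMU; apply/theta_diffopU/theta_ringM => //; apply: theta_ring_shift.
Qed.

End ThetaRing.

(** * Partial fractions *)

(** When d - a is constant, this identity lowers the order of the pole at d. *)
Lemma frac_sub_poles (F : fieldType) (g a d w : F) : a != 0 -> d != 0 -> w != 0 ->
  (d - a) * (g / (d * w) / a) = g / w / a - g / (d * w).
Proof. by move=> a0 d0 w0; field; rewrite a0 d0 w0. Qed.

Section PartialFractions.
Variables (k : fieldType) (B : comNzRingType) (v : {rmorphism B -> k}).
Variables (J : Type) (c : J -> B).
Hypothesis v_inj : injective v.
Hypothesis c_diff : forall x y, c x = c y \/
  exists (u : nat) (z : int), (0 < u)%N /\ u%:R = z%:~R * (c x - c y).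
Local Notation F := {fraction {poly k}}.
Local Notation pi x := (polyF v ('X - (c x)%:P)).

(** The exponent is shifted by one so that each entry of the list stands for a term with pole order
    at least 1. *)
Definition polar_part (L : seq (B * J * nat)) : F :=
  \sum_(t <- L) polyF v t.1.1%:P / polyF v (('X - (c t.1.2)%:P) ^+ t.2.+1).

(** Over B partial fractions exist only up to a positive integer factor M: by [c_diff], the
    difference of two distinct poles divides a positive integer but need not be invertible. *)
Definition has_pfrac (f : F) : Prop := exists (M : nat) (a : {poly B}) L,
  (0 < M)%N /\ M%:R * f = polyF v a + polar_part L.

Lemma pole_neq0 x : pi x != 0.
Proof.
rewrite -(rmorph0 (polyF v)) (inj_eq (polyF_inj v_inj)).
exact/monic_neq0/monicXsubC.
Qed.

Lemma polar_partZ (b : B) L :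
  polyF v b%:P * polar_part L =
  polar_part [seq (b * t.1.1, t.1.2, t.2) | t <- L].
Proof.
rewrite /polar_part big_map mulr_sumr; apply: eq_bigr => t _.
by rewrite polyCM rmorphM mulrA.
Qed.

Lemma polar_part_cat L L' : polar_part (L ++ L') = polar_part L + polar_part L'.
Proof. by rewrite /polar_part big_cat. Qed.

Lemma pfrac_img a : has_pfrac (polyF v a).
Proof. by exists 1%N, a, [::]; rewrite /polar_part big_nil mul1r addr0. Qed.

Lemma pfracZ b f : has_pfrac f -> has_pfrac (polyF v b%:P * f).
Proof.
case=> M [a [L [M_gt0 E]]]; exists M, (b%:P * a).
exists [seq (b * t.1.1, t.1.2, t.2) | t <- L]; split=> //.
by rewrite mulrCA E mulrDr polar_partZ rmorphM.
Qed.

Lemma pfrac_divn u f : (0 < u)%N -> has_pfrac (u%:R * f) -> has_pfrac f.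
Proof.
move=> u_gt0 [M [a [L [M_gt0 E]]]]; exists (M * u)%N, a, L.
by rewrite muln_gt0 M_gt0 natrM -mulrA.
Qed.

Lemma pfracMz z f : has_pfrac f -> has_pfrac (z%:~R * f).
Proof.
have -> : z%:~R = polyF v z%:~R%:P by rewrite !rmorph_int.
exact: pfracZ.
Qed.

Lemma pfracD f g : has_pfrac f -> has_pfrac g -> has_pfrac (f + g).
Proof.
case=> M [a [L [M_gt0 Ef]]] [M' [a' [L' [M'_gt0 Eg]]]].
apply: (@pfrac_divn (M * M')%N); first by rewrite muln_gt0 M_gt0.
have -> : (M * M')%N%:R * (f + g) = M'%:R * (M%:R * f) + M%:R * (M'%:R * g).
  by rewrite mulrDr natrM mulrAC [_%:R * _%:R * g]mulrC; ring.
have nE (u : nat) : u%:R = polyF v u%:R%:P by rewrite !rmorph_nat.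
exists 1%N, (M'%:R%:P * a + M%:R%:P * a').
exists ([seq (M'%:R * t.1.1, t.1.2, t.2) | t <- L] ++
        [seq (M%:R * t.1.1, t.1.2, t.2) | t <- L']).
rewrite mul1r Ef Eg polar_part_cat -!polar_partZ.
rewrite rmorphD !rmorphM -!nE !mulrDr; split=> //; exact: addrACA.
Qed.

Lemma pfrac_pole b x e : has_pfrac (polyF v b%:P / pi x ^+ e.+1).
Proof.
exists 1%N, 0, [:: (b, x, e)].
by rewrite /polar_part big_seq1 mul1r rmorph0 add0r rmorphXn.
Qed.

(* For distinct poles, u = z (c x - c y) gives
   u / ((t - c x) (t - c y)) = z (1 / (t - c x) - 1 / (t - c y)). *)
Lemma pfrac_pole_div b x y e : has_pfrac (polyF v b%:P / pi y ^+ e.+1 / pi x).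
Proof.
have px0 := pole_neq0 x; have py0 := pole_neq0 y.
have [cE | [u [z [u_gt0 uE]]]] := c_diff x y.
  by rewrite cE -mulrA -invfM -exprSr; apply: pfrac_pole.
have uF : u%:R = z%:~R * (pi y - pi x).
  have -> : u%:R = polyF v u%:R%:P by rewrite !rmorph_nat.
  have -> : z%:~R = polyF v z%:~R%:P by rewrite !rmorph_int.
  by rewrite uE -rmorphB -rmorphM polyCM polyCB; congr (polyF v (_ * _)); ring.
have step i : u%:R * (polyF v b%:P / pi y ^+ i.+1 / pi x) =
    z%:~R * (polyF v b%:P / pi y ^+ i / pi x) +
    (- z)%:~R * (polyF v b%:P / pi y ^+ i.+1).
  rewrite uF mulrNz mulNr -[LHS]mulrA -mulrBr; congr (_ * _).
  by rewrite exprS; apply: (frac_sub_poles _ px0 py0 (expf_neq0 i py0)).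
elim: e => [|e IH]; apply: (pfrac_divn u_gt0); rewrite step; apply: pfracD;
  apply: pfracMz; rewrite ?expr0 ?divr1.
- exact: (pfrac_pole b x 0).
- exact: (pfrac_pole b y 0).
- exact: IH.
exact: pfrac_pole.
Qed.

(** The polynomial part is divided by t - c x with remainder, by induction on its degree; the polar
    part is treated term by term with [pfrac_pole_div]. *)
Lemma pfrac_div f x : has_pfrac f -> has_pfrac (f / pi x).
Proof.
case=> M [a [L [M_gt0 E]]]; apply: (pfrac_divn M_gt0); rewrite mulrA E mulrDl.
apply: pfracD.
  elim/poly_ind: a {E} => [|a b IH].
    by rewrite rmorph0 mul0r -(rmorph0 (polyF v)); apply: pfrac_img.
  have -> : a * 'X + b%:P = a * ('X - (c x)%:P) + (c x)%:P * a + b%:P by ring.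
  rewrite 2!(rmorphD (polyF v)) 2!(rmorphM (polyF v)) !mulrDl.
  rewrite (mulfK (pole_neq0 x)); apply: pfracD; last first.
    by have := pfrac_pole b x 0; rewrite expr1.
  apply: pfracD; first exact: pfrac_img.
  by rewrite -mulrA; apply: pfracZ.
rewrite /polar_part mulr_suml; elim/big_ind: _ => [|? ?|t _].
- by rewrite -(rmorph0 (polyF v)); apply: pfrac_img.
- exact: pfracD.
by rewrite rmorphXn; apply: pfrac_pole_div.
Qed.

Lemma theta_ring_pfrac f : theta_ring v c f -> has_pfrac f.
Proof.
case=> -[a d] [[l]]; rewrite /fst /snd => -> ->; elim: l => [|x l IH].
  by rewrite big_nil rmorph1 divr1; apply: pfrac_img.
by rewrite big_cons rmorphM [pi x * _]mulrC invfM mulrA; apply: pfrac_div.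
Qed.

End PartialFractions.

(** * The operator T_eps on partial fractions *)

Section TEpsilon.
Variables (K : fieldType) (T : {fraction {poly K}} -> {fraction {poly K}}).
Hypothesis T_eps : is_T_eps T.
Local Notation F := {fraction {poly K}}.

Lemma T_epsD (f g : F) : T (f + g) = T f + T g.
Proof.
case: T_eps => Tlin _ _; have := Tlin 1 f g.
by rewrite polyC1 tofrac1 !mul1r.
Qed.

Lemma T_eps0 : T 0 = 0.
Proof. by apply: (addrI (T 0)); rewrite -T_epsD !addr0. Qed.

Lemma T_epsZ (a : K) (f : F) : T (a%:P%:F * f) = a%:P%:F * T f.
Proof. by case: T_eps => Tlin _ _; have := Tlin a f 0; rewrite T_eps0 !addr0. Qed.

Lemma T_eps_sum (I : Type) (L : seq I) (G : I -> F) :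
  T (\sum_(t <- L) G t) = \sum_(t <- L) T (G t).
Proof. exact: (big_morph T T_epsD T_eps0). Qed.

Lemma T_eps_poly (q : {poly K}) : T q%:F = 0.
Proof.
case: T_eps => _ TX _; rewrite -[q]coefK poly_def raddf_sum T_eps_sum big1 // => i _.
by rewrite -mul_polyC /= tofracM tofracXn T_epsZ TX mulr0.
Qed.

Lemma T_eps_pole (a x : K) (e : nat) :
  T (a%:P%:F / (('X - x%:P) ^+ e.+1)%:F) = a%:P%:F * ('X%:F^-1) ^+ e.+1.
Proof.
by case: T_eps => _ _ TV; rewrite T_epsZ tofracXn tofracB TV // exprVn.
Qed.

End TEpsilon.

Section PolePolynomial.
Variables (B : comNzRingType) (J : Type).
Implicit Type L : seq (B * J * nat).

(** A polar part with the positions of its poles forgotten. Its value at 1/eps is the result of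
    T_eps, and its value at -1/s is the trace, so it links the two sides. *)
Definition pole_poly L : {poly B} := \sum_(t <- L) t.1.1 *: 'X^(t.2.+1).

Lemma horner_pole_poly (S : comNzRingType) (g : {rmorphism B -> S}) L (y : S) :
  (map_poly g (pole_poly L)).[y] = \sum_(t <- L) g t.1.1 * y ^+ t.2.+1.
Proof.
rewrite rmorph_sum horner_sum; apply: eq_bigr => t _.
by rewrite /= map_polyZ hornerZ map_polyXn hornerXn.
Qed.

(** T_eps kills the polynomial part and moves every pole to 0, so the positions [t.1.2] disappear; M
    passes through T_eps by linearity. *)
Lemma T_eps_pfrac (k K : fieldType) (iota : {rmorphism k -> K})
    (T : {fraction {poly K}} -> {fraction {poly K}}) (v : {rmorphism B -> k})
    (c : J -> B) (M : nat) (f : {fraction {poly k}}) (a : {poly B}) L :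
    injective v -> is_T_eps T -> M%:R * f = polyF v a + polar_part v c L ->
  M%:R * T (frac_map (map_poly iota) f) =
    \sum_(t <- L) (iota (v t.1.1))%:P%:F * ('X%:F^-1) ^+ t.2.+1.
Proof.
move=> v_inj T_eps fE.
have i_inj : injective (map_poly iota) by exact: map_poly_inj.
pose G : {rmorphism {fraction {poly k}} -> {fraction {poly K}}} :=
  HB.pack (frac_map (map_poly iota))
    (GRing.isZmodMorphism.Build _ _ _ (frac_map_is_zmod_morphism i_inj))
    (GRing.isMonoidMorphism.Build _ _ _ (frac_map_is_monoid_morphism i_inj)).
have GF (b : {poly B}) : G (polyF v b) = (map_poly iota (map_poly v b))%:F.
  exact: (frac_map_tofrac i_inj).
have nE : M%:R = (M%:R : K)%:P%:F by rewrite !rmorph_nat.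
rewrite nE -(T_epsZ T_eps) -nE -[frac_map _ f]/(G f) -(rmorph_nat G) -rmorphM fE.
rewrite rmorphD (T_epsD T_eps) GF (T_eps_poly T_eps) add0r rmorph_sum.
rewrite (T_eps_sum T_eps); apply: eq_bigr => t _.
rewrite fmorph_div !GF map_polyC /= map_polyC /= !rmorphXn /= !rmorphB /=.
by rewrite !map_polyX !map_polyC /= -rmorphB -rmorphXn (T_eps_pole T_eps).
Qed.

End PolePolynomial.

(** * Representations of the localized Weyl algebra *)

Section ThetaRepresentation.
Variables (k : fieldType) (B : comNzRingType) (v : {rmorphism B -> k}).
Variables (J : Type) (c : J -> B) (sh : J -> int -> J).
Hypotheses (v_inj : injective v) (c_sh : forall x m, c (sh x m) = c x - m%:~R).
Variables (K : comUnitRingType) (n : nat) (h : {rmorphism B -> K}).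
Local Notation p := n.+1.
Hypotheses (p_pr : prime p) (pK : p%:R = 0 :> K).
Variables (X D : 'M[K]_p) (s : K).
Hypotheses (X_unit : X \is a GRing.unit) (s_unit : s \is a GRing.unit).
Hypothesis commDX : D * X = X * D + 1.
Hypothesis XpDp : X ^+ p * D ^+ p = s%:M.
Hypothesis trXD : \tr (X ^+ n * D ^+ n) = -1.
Hypothesis hc_nat : forall x, exists l : nat, h (c x) = l%:R.
Local Notation Theta := (X * D).
Local Notation F := {fraction {poly k}}.
Local Notation theta_ring := (theta_ring v c).
Local Notation theta_den := (theta_den c).
Local Notation theta_diffop := (theta_diffop v c).

Definition theta_eval : {rmorphism {poly B} -> 'M[K]_p} :=
  (horner_mx Theta \o map_poly h).

Lemma theta_evalX : theta_eval 'X = Theta.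
Proof. by rewrite /= map_polyX horner_mx_X. Qed.

Lemma theta_evalC b : theta_eval b%:P = (h b)%:M.
Proof. by rewrite /= map_polyC horner_mx_C. Qed.

(** By [hc_nat] each factor t - c x becomes Theta - l with l a natural number, a conjugate of the
    invertible Theta. *)
Lemma theta_eval_unit d : theta_den d -> theta_eval d \is a GRing.unit.
Proof.
case=> l ->; rewrite rmorph_prod; apply: rpred_prod => x _.
rewrite rmorphB theta_evalX theta_evalC; have [m ->] := hc_nat x.
rewrite (rmorph_nat (@scalar_mx K p)).
exact: (Theta_subn_unit p_pr pK X_unit s_unit).
Qed.

Definition theta_ext : F -> 'M[K]_p := loc_ext (polyF v) theta_den theta_eval.

Lemma theta_extE a d : theta_den d ->
  theta_ext (polyF v a / polyF v d) = theta_eval a / theta_eval d.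
Proof.
apply: loc_extE; [exact: polyF_inj | exact: theta_den_neq0 | exact: theta_eval_unit].
Qed.

Lemma theta_ext_img a : theta_ext (polyF v a) = theta_eval a.
Proof.
apply: loc_ext_img; first exact: polyF_inj.
- exact: theta_den1.
- exact: theta_den_neq0.
exact: theta_eval_unit.
Qed.

Lemma theta_ext0 : theta_ext 0 = 0.
Proof. by rewrite -(rmorph0 (polyF v)) theta_ext_img rmorph0. Qed.

Lemma theta_extD f g : theta_ring f -> theta_ring g ->
  theta_ext (f + g) = theta_ext f + theta_ext g.
Proof.
apply: loc_extD; first exact: polyF_inj.
- exact: theta_denM.
- exact: theta_den_neq0.
exact: theta_eval_unit.
Qed.

Lemma theta_extM f g : theta_ring f -> theta_ring g ->
  theta_ext (f * g) = theta_ext f * theta_ext g.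
Proof.
apply: loc_extM; first exact: polyF_inj.
- exact: theta_denM.
- exact: theta_den_neq0.
exact: theta_eval_unit.
Qed.

(** The matrix form of the rule f(t) x^m = x^m f(t + m), by induction on the degree from the case of
    t itself. *)
Lemma theta_eval_shift (a : {poly B}) (m : int) :
  X ^ m * theta_eval (a \Po ('X + m%:~R%:P)) = theta_eval a * X ^ m.
Proof.
elim/poly_ind: a => [|a b IH]; first by rewrite comp_poly0 !rmorph0 mulr0 mul0r.
rewrite comp_poly_MXaddC !rmorphD !rmorphM /= -![horner_mx _ _]/(theta_eval _).
rewrite mulrDr mulrA IH -/(theta_eval _) !theta_evalC mulrDl; congr (_ + _).
  rewrite rmorphD theta_evalX theta_evalC rmorph_int.
  rewrite (rmorph_int (@scalar_mx K p)) -!mulrA; congr (_ * _).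
  by rewrite -(Theta_exprzX X_unit commDX) mulrA.
exact: scalar_mxC.
Qed.

Lemma theta_ext_shift f m : theta_ring f ->
  X ^ m * theta_ext (frac_shift m f) = theta_ext f * X ^ m.
Proof.
case=> -[a d] [/= dd ->]; have dd' := theta_den_shift c_sh m dd.
rewrite (frac_shift_polyF v_inj _ _ dd) !theta_extE //.
have [ud ud'] := (theta_eval_unit dd, theta_eval_unit dd').
rewrite mulrA theta_eval_shift -!mulrA; congr (_ * _).
apply: (mulrI ud); rewrite mulVKr // mulrA -theta_eval_shift mulrK //.
Qed.

(** The normal form of an operator is unique, so the representation is defined on it directly and
    multiplicativity becomes a theorem. *)
Definition diffop_mx (a : diffop k) : 'M[K]_p :=
  \sum_(j <- msupp a) X ^ j * theta_ext a@_j.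

Lemma diffop_mxw (S : {fset int}) a : (msupp a `<=` S)%fset ->
  diffop_mx a = \sum_(j <- S) X ^ j * theta_ext a@_j.
Proof.
move=> sS; rewrite /diffop_mx (big_fset_incl _ sS) //= => j _ /mcoeff_outdom ->.
by rewrite theta_ext0 mulr0.
Qed.

Lemma diffop_mxU u j : diffop_mx << u *g j >> = X ^ j * theta_ext u.
Proof. by rewrite (diffop_mxw msuppU_le) big_seq_fset1 mcoeffUU. Qed.

Lemma diffop_mxD a b : theta_diffop a -> theta_diffop b ->
  diffop_mx (a + b) = diffop_mx a + diffop_mx b.
Proof.
move=> Sa Sb; rewrite (diffop_mxw (msuppD_le a b)).
rewrite (@diffop_mxw (msupp a `|` msupp b)%fset a) ?fsubsetUl //.
rewrite (@diffop_mxw (msupp a `|` msupp b)%fset b) ?fsubsetUr //.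
rewrite -big_split /=; apply: eq_bigr => j _.
by rewrite mcoeffD theta_extD // mulrDr.
Qed.

Lemma diffop_mx0 : diffop_mx 0 = 0.
Proof. by rewrite /diffop_mx msupp0 big_seq_fset0. Qed.

Lemma diffop_mxB a b : theta_diffop a -> theta_diffop b ->
  diffop_mx (a - b) = diffop_mx a - diffop_mx b.
Proof.
move=> Sa Sb; apply/eqP; rewrite eq_sym subr_eq -diffop_mxD ?subrK //.
exact: theta_diffopB.
Qed.

(** Additivity in each argument reduces the claim to two monomials, where it is the shift rule
    [theta_ext_shift]. *)
Lemma diffop_mxM a b : theta_diffop a -> theta_diffop b ->
  diffop_mx (a * b) = diffop_mx a * diffop_mx b.
Proof.
have SM := theta_diffopM v_inj c_sh; have ind := @theta_diffop_ind _ _ v _ c v_inj.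
move=> Sa Sb; elim/ind: a / Sa => [|a a' Sa Sa' Ha Ha'|u i Su].
- by rewrite mul0r diffop_mx0 mul0r.
- by rewrite mulrDl !diffop_mxD ?mulrDl ?Ha ?Ha' //; apply: SM.
have SU : theta_diffop << u *g i >> by apply: theta_diffopU.
elim/ind: b / Sb => [|b b' Sb Sb' Hb Hb'|w j Sw].
- by rewrite mulr0 diffop_mx0 mulr0.
- by rewrite mulrDr !diffop_mxD ?mulrDr ?Hb ?Hb' //; apply: SM.
rewrite diffopMU !diffop_mxU theta_extM //; last exact: theta_ring_shift.
by rewrite exprzDr // -!mulrA; congr (_ * _); rewrite !mulrA theta_ext_shift.
Qed.

(** Since f(Theta) commutes with Theta, M = X^j f(Theta) satisfies Theta M = M Theta + j M. Taking
    traces gives j tr M = 0, and j is invertible modulo p. *)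
Lemma mxtrace_exprz_theta_ext (j : int) f : theta_ring f ->
  j != 0 -> (`|j| < p)%N -> \tr (X ^ j * theta_ext f) = 0.
Proof.
move=> Sf j0 lt_jp; set M := X ^ j * _.
have SX : theta_ring (polyF v 'X) by apply: theta_ring_img.
have ThM : Theta * M = M * Theta + j%:~R * M.
  rewrite mulrA (Theta_exprzX X_unit commDX) mulrDr mulrDl -!mulrA; congr (_ + _).
    congr (_ * _); rewrite mulrA -theta_evalX -theta_ext_img -!theta_extM //.
    by rewrite mulrC.
  by rewrite mulrA mulrA (commr_int (X ^ j) j) -mulrA.
have: \tr (Theta * M) = \tr (M * Theta) by exact: mxtrace_mulC.
rewrite ThM raddfD /= => /(canRL (addKr _)); rewrite addNr => trjM.
apply: (natr_torsion_free p_pr pK (m := `|j|)); first by rewrite absz_gt0 j0 -ltnS.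
move: trjM; rewrite mulrzl raddfMz /= mulr_natl; case: (j) => i.
  by rewrite -pmulrn => ->.
by rewrite NegzE mulrNz -pmulrn => /eqP; rewrite oppr_eq0 => /eqP.
Qed.

Lemma mxtrace_diffop (a : diffop k) : theta_diffop a ->
    (forall j : int, j \in msupp a -> (`|j| < p)%N) ->
  \tr (diffop_mx a) = \tr (theta_ext a@_0).
Proof.
(* The index 0 is adjoined because it may be missing from the support. *)
move=> Sa lt_p; rewrite (@diffop_mxw (0 |` msupp a)%fset) ?fsubsetUr //.
rewrite (bigD1_seq (0 : int)) /= ?fset1U1 ?fset_uniq // expr0z mul1r.
rewrite raddfD /= [X in _ + X]raddf_sum /= big1 ?addr0 // => j j0.
have [/lt_p lt_jp | /mcoeff_outdom ->] := boolP (j \in msupp a).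
  exact: mxtrace_exprz_theta_ext.
by rewrite theta_ext0 mulr0 raddf0.
Qed.

Lemma mxtrace_theta_pole (x : J) (b : B) (e : nat) : (e <= n)%N ->
  \tr (theta_ext (polyF v b%:P / polyF v (('X - (c x)%:P) ^+ e.+1)))
    = h b * (- s)^-1 ^+ e.+1.
Proof.
move=> le_en; rewrite theta_extE; last exact: theta_den_pole.
rewrite rmorphXn rmorphB theta_evalX !theta_evalC; have [m ->] := hc_nat x.
rewrite (rmorph_nat (@scalar_mx K p)) -exprVn -[_ * _]/(_ *m _) mul_scalar_mx.
rewrite linearZ /= (mxtrace_Theta_subnV p_pr pK X_unit s_unit commDX XpDp).
by rewrite (mxtrace_ThetaV_exp p_pr pK X_unit s_unit commDX XpDp trXD).
Qed.

Lemma mxtrace_theta_poly (a : {poly B}) : (size a <= n)%N ->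
  \tr (theta_ext (polyF v a)) = 0.
Proof.
move=> le_an; rewrite theta_ext_img.
apply: (mxtrace_horner_Theta p_pr pK X_unit commDX).
exact: leq_trans (size_poly _ _) le_an.
Qed.

(** The counterpart of [T_eps_pfrac] on the trace side. The bounds on L and a say that pole orders
    are at most p and that the polynomial part has degree below p - 1, hence trace 0. *)
Lemma mxtrace_pfrac (M : nat) f (a : {poly B}) (L : seq (B * J * nat)) :
    theta_ring f -> M%:R * f = polyF v a + polar_part v c L ->
    (size a <= n)%N -> all (fun t => t.2 <= n)%N L ->
  M%:R * \tr (theta_ext f) = (map_poly h (pole_poly L)).[(- s)^-1].
Proof.
move=> Sf fE le_an le_L.
have SL (L' : seq (B * J * nat)) : theta_ring (polar_part v c L').
  elim: L' => [|t L' IH]; first by rewrite /polar_part big_nil; apply: theta_ring0.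
  rewrite /polar_part big_cons; apply: theta_ringD => //.
  exact/loc_frac/theta_den_pole.
have -> : M%:R * \tr (theta_ext f) = \tr (theta_ext (M%:R * f)).
  have -> : M%:R = polyF v M%:R%:P by rewrite !rmorph_nat.
  rewrite theta_extM ?theta_ext_img //; last exact: theta_ring_img.
  by rewrite theta_evalC rmorph_nat -linearZ -mul_scalar_mx.
rewrite fE theta_extD //; last exact: theta_ring_img.
rewrite raddfD /= mxtrace_theta_poly // add0r horner_pole_poly.
elim: L le_L {fE} => [|t L IH] /=.
  by rewrite /polar_part !big_nil theta_ext0 raddf0.
case/andP=> le_tn le_L; rewrite /polar_part !big_cons theta_extD; last 2 first.
- exact/loc_frac/theta_den_pole.
- exact: SL.
rewrite raddfD /= mxtrace_theta_pole //; congr (_ + _).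
exact: IH.
Qed.

End ThetaRepresentation.

(** * Reduction modulo p *)

(** The generated subring is an intersection of subrings, so [P] is packed as one of them. *)
Lemma subring_gen_ind (A : nzRingType) (Y : A -> Prop) (P : A -> Prop) :
    P 1 -> (forall a b, P a -> P b -> P (a - b)) ->
    (forall a b, P a -> P b -> P (a * b)) -> (forall a, Y a -> P a) ->
  forall a, a \in subring_gen Y -> P a.
Proof.
move=> P1 PB PM PY a /asboolP ha; pose Q : {pred A} := fun b => `[< P b >].
have Q_closed : subring_closed Q.
  by split=> [|b b' /asboolP Pb /asboolP Pb'|b b' /asboolP Pb /asboolP Pb'];
    apply/asboolP; [exact: P1 | exact: PB | exact: PM].
pose QS : subringClosed A := HB.pack Q (GRing.isSubringClosed.Build A Q Q_closed).
by apply/asboolP; apply: (ha QS) => b /PY Pb; apply/asboolP.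
Qed.

Lemma rmorph_div_natr (A S : comNzRingType) (f : {rmorphism A -> S}) (a b : A)
    (d w : nat) :
  a * d%:R = b -> w%:R * d%:R = 1 :> S -> f a = f b * w%:R.
Proof. by move=> <- wd; rewrite rmorphM rmorph_nat mulrAC -mulrA wd mulr1. Qed.

(** Through this, the values on R, x and d/dx determine a representation on the adjoined
    inverses. *)
Lemma rmorph_eq_inv (A S : pzRingType) (f g : {rmorphism A -> S}) (u w : A) :
  u * w = 1 -> w * u = 1 -> f u = g u -> f w = g w.
Proof.
move=> uw wu fgu; rewrite -[LHS]mulr1 -(rmorph1 g) -uw rmorphM mulrA -fgu.
by rewrite -rmorphM wu rmorph1 mul1r.
Qed.

(** * The poles r_j - m over R *)

Section BaseChange.
Variables (k : fieldType) (k_char0 : [pchar k] =i pred0).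
Variables (R : subringClosed k) (n : nat) (r : 'I_n -> rat).
Hypothesis r_in_R : forall j, ratr (r j) \in R.
Local Notation B := (subring_type R).
Local Notation J := ('I_n * int)%type.

Definition root_elt (j : 'I_n) : B := Sub (ratr (r j)) (r_in_R j).
Definition shifted_root (x : J) : B := root_elt x.1 - x.2%:~R.
Definition val_R : {rmorphism B -> k} := val.

Lemma val_R_inj : injective val_R.
Proof. exact: val_inj. Qed.

Lemma shifted_root_shift x m :
  shifted_root (x.1, x.2 + m) = shifted_root x - m%:~R.
Proof. by rewrite /shifted_root /= intrD opprD addrA. Qed.

Lemma intr_eq0_char0 (z : int) : (z%:~R == 0 :> k) = (z == 0).
Proof.
have natE m : (m%:R == 0 :> k) = (m == 0)%N by move/pcharf0P: k_char0.
by case: z => m; rewrite ?NegzE ?mulrNz ?oppr_eq0 -pmulrn natE.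
Qed.

Lemma root_elt_denq j : root_elt j * (`|denq (r j)|%N)%:R = (numq (r j))%:~R.
Proof.
apply: val_R_inj; rewrite rmorphM rmorph_nat rmorph_int /= /ratr.
rewrite pmulrn gtz0_abs ?denq_gt0 // mulrVK // unitfE intr_eq0_char0.
exact: denq_neq0.
Qed.

(** The difference of two poles is a rational number w / q, with q a product of denominators. If w
    is nonzero, then u = |w| and z = sgn(w) q. *)
Lemma shifted_root_diff x y : shifted_root x = shifted_root y \/
  exists (u : nat) (z : int), (0 < u)%N /\
    u%:R = z%:~R * (shifted_root x - shifted_root y).
Proof.
pose d j := `|denq (r j)|%N; pose q : nat := (d x.1 * d y.1)%N.
pose w : int := numq (r x.1) * (d y.1)%:Z - numq (r y.1) * (d x.1)%:Z
  + (y.2 - x.2) * q%:Z.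
have qw : q%:R * (shifted_root x - shifted_root y) = w%:~R.
  rewrite /shifted_root /w !(intrD, mulrNz, intrM) -!root_elt_denq -!pmulrn.
  rewrite -/(d _) natrM; ring.
have q_gt0 : (0 < q)%N by rewrite muln_gt0 !absz_gt0 !denq_neq0.
have [w0|w0] := eqVneq w 0.
  left; apply/eqP; rewrite -subr_eq0; apply/eqP/val_R_inj.
  move/(congr1 val_R): qw; rewrite w0 rmorphM rmorph_nat rmorph0 => /eqP.
  by rewrite mulf_eq0 pmulrn intr_eq0_char0 eqz_nat gtn_eqF // => /eqP.
right; exists `|w|%N, (sgz w * q%:Z); split; first by rewrite absz_gt0.
by rewrite intrM -mulrA -pmulrn qw -intrM pmulrn -abszEsg.
Qed.

(** Among the generators only the adjoined inverses have a pole, and it is r_i - m. *)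
Lemma Diffbar_theta_diffop a :
  a \in Diffbar_pred R r -> theta_diffop val_R shifted_root a.
Proof.
have SU := @theta_diffopU _ _ val_R _ shifted_root.
have S1 : theta_ring val_R shifted_root 1.
  by rewrite -(rmorph1 (polyF val_R)); apply: theta_ring_img.
move: a; apply: subring_gen_ind => [|a b|a b|a].
- exact: SU.
- exact: (theta_diffopB val_R_inj).
- exact: (theta_diffopM val_R_inj shifted_root_shift).
case=> [_ [c cR|||] | i m].
- apply: SU; have := theta_ring_img val_R shifted_root (Sub c cR)%:P.
  by rewrite polyFC.
- exact: SU.
- by rewrite xopV; apply: SU.
- by apply: SU; rewrite -(polyFX val_R); apply: theta_ring_img.
have poleE : ('X - (ratr (r i))%:P + m%:~R%:P)%:F =
    polyF val_R ('X - (shifted_root (i, m))%:P).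
  have cE : val_R (shifted_root (i, m)) = ratr (r i) - m%:~R.
    by rewrite rmorphB; congr (_ - _); exact: rmorph_int.
  rewrite rmorphB polyFX polyFC cE -tofracB; congr (_%:F).
  by rewrite polyCB opprB addrA addrAC.
rewrite theta_shiftE poleE fopV; last exact: pole_neq0 val_R_inj _.
apply: SU; rewrite -[_^-1]mul1r -(rmorph1 (polyF val_R)) -['X - _]expr1.
exact/loc_frac/(theta_den_pole _ _ 1).
Qed.

(** * Existence, uniqueness and trace of the representation modulo p *)

Section ModP.
Variables (n' : nat) (I : idealr B).
Local Notation p := n'.+1.
Hypotheses (p_pr : prime p) (Ip : is_pideal p I).
Hypothesis p_gt_denq : forall j, (`|denq (r j)| < p)%N.
Local Notation K := (fun_ring I).

Definition mod_p : {rmorphism B -> {ideal_quot I}} := \pi_{ideal_quot I}%qT.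
Definition scal_rmorph : {rmorphism {ideal_quot I} -> K} :=
  (@to_total_fraction {poly {poly {ideal_quot I}}} \o polyC \o polyC).
Definition base_change : {rmorphism B -> K} := (scal_rmorph \o mod_p).

Lemma mod_p_natr0 : p%:R = 0 :> {ideal_quot I}.
Proof.
have /eqP : mod_p p%:R == mod_p 0.
  by rewrite -Quotient.idealrBE subr0; apply/Ip; exists 1; rewrite mulr1.
by rewrite rmorph0 rmorph_nat.
Qed.

Lemma base_change_natr0 : p%:R = 0 :> K.
Proof.
by have := congr1 scal_rmorph mod_p_natr0; rewrite rmorph_nat rmorph0.
Qed.

(** The denominator of r_j is smaller than p, so it has an inverse w modulo p and the pole reduces
    to an integer. *)
Lemma base_change_root x : exists l : nat, base_change (shifted_root x) = l%:R.
Proof.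
have pK := base_change_natr0.
have [|w wE] := natr_inv p_pr pK (m := `|denq (r x.1)|).
  by rewrite gtnNdvd // absz_gt0 denq_neq0.
have [l lE] := intr_natr p_pr pK (numq (r x.1) * w%:Z - x.2).
exists l; rewrite -lE rmorphB rmorph_int intrB intrM -pmulrn; congr (_ - _).
by rewrite (rmorph_div_natr base_change (root_elt_denq x.1) wE) rmorph_int.
Qed.

(** R/(p) may have zero divisors; the variable is nevertheless regular because its leading
    coefficient is 1. *)
Lemma xi_unit : xi_elt I \is a GRing.unit.
Proof.
apply: to_total_fraction_unit; apply: lreg_lead; rewrite lead_coefC.
by apply: lreg_lead; rewrite lead_coefX; apply: lreg1.
Qed.

Lemma eta_unit : eta_elt I \is a GRing.unit.
Proof.
by apply/to_total_fraction_unit/lreg_lead; rewrite lead_coefX; apply: lreg1.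
Qed.

Local Notation X := (@mx_x k R p I).
Local Notation D := (@mx_d k R p I).
Local Notation s := (xi_elt I ^+ p * eta_elt I ^+ p).

Lemma mx_dE : D = dshift_mx n' (eta_elt I). Proof. by []. Qed.

Lemma mx_x_expp : X ^+ p = (xi_elt I ^+ p)%:M.
Proof. exact: xshift_mx_expp p_pr base_change_natr0 _. Qed.

Lemma mx_xd_expp : X ^+ p * D ^+ p = s%:M.
Proof.
rewrite mx_x_expp mx_dE (dshift_mx_expp p_pr base_change_natr0).
exact/esym/(rmorphM (@scalar_mx K p)).
Qed.

Lemma mx_x_unit : X \is a GRing.unit.
Proof.
have: X ^+ p \is a GRing.unit.
  by rewrite mx_x_expp -[_ \is a _]/(_ \in unitmx) unitmxE det_scalar !unitrX ?xi_unit.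
by rewrite unitrX_pos.
Qed.

Lemma s_unit : s \is a GRing.unit.
Proof. by rewrite unitrM !unitrX ?xi_unit ?eta_unit. Qed.

Lemma mx_dx : D * X = X * D + 1.
Proof. exact: dshift_xshift_mx base_change_natr0 _ _. Qed.

Lemma mxtrace_mx_xd : \tr (X ^+ n' * D ^+ n') = -1.
Proof. exact: mxtrace_xshift_dshift p_pr base_change_natr0 _ _. Qed.

Definition rho_p (u : Diffbar R r) : 'M[K]_p :=
  diffop_mx val_R shifted_root base_change X D (val u).

Lemma rho_p_zmod : zmod_morphism rho_p.
Proof.
move=> u w; apply: (diffop_mxB val_R_inj p_pr base_change_natr0 mx_x_unit s_unit
  mx_dx mx_xd_expp base_change_root); exact/Diffbar_theta_diffop/valP.
Qed.

Lemma rho_p_monoid : monoid_morphism rho_p.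
Proof.
have ext_img := theta_ext_img val_R_inj p_pr base_change_natr0 mx_x_unit s_unit
  mx_dx mx_xd_expp base_change_root.
split=> [|u w].
  rewrite /rho_p (diffop_mxU val_R_inj p_pr base_change_natr0 mx_x_unit s_unit
    mx_dx mx_xd_expp base_change_root).
  by rewrite -(rmorph1 (polyF val_R)) ext_img rmorph1 mulr1.
apply: (diffop_mxM val_R_inj shifted_root_shift p_pr base_change_natr0 mx_x_unit
  s_unit mx_dx mx_xd_expp base_change_root); exact/Diffbar_theta_diffop/valP.
Qed.

HB.instance Definition _ := GRing.isZmodMorphism.Build _ _ rho_p rho_p_zmod.
HB.instance Definition _ := GRing.isMonoidMorphism.Build _ _ rho_p rho_p_monoid.

Lemma rho_p_is_rho_p : is_rho_p rho_p.
Proof.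
have ext_img := theta_ext_img val_R_inj p_pr base_change_natr0 mx_x_unit s_unit
  mx_dx mx_xd_expp base_change_root.
have mxU := diffop_mxU val_R_inj p_pr base_change_natr0 mx_x_unit s_unit
  mx_dx mx_xd_expp base_change_root.
move=> u; split=> [c uE|uE|uE]; rewrite -[LHS]/(rho_p u) /rho_p.
- rewrite uE mxU expr0z mul1r -(polyFC val_R) ext_img.
  exact: theta_evalC.
- by rewrite uE mxU -(rmorph1 (polyF val_R)) ext_img rmorph1 mulr1.
(* [dop] is x^-1 times x d/dx, so it goes to X^-1 Theta = D. *)
rewrite uE mxU -(polyFX val_R) ext_img theta_evalX.
by rewrite exprN1 mulKr ?mx_x_unit.
Qed.

Lemma is_rho_p_uniq (rho : {rmorphism Diffbar R r -> 'M[K]_p}) :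
  is_rho_p rho -> rho =1 rho_p.
Proof.
(* Bundling the membership proof makes [P] a predicate on all of [diffop k], to which
   [subring_gen_ind] applies. *)
move=> rhoP; pose P a := exists h : a \in Diffbar_pred R r,
  rho (Sub a h) = rho_p (Sub a h).
have P1 : P 1.
  exists (rpred1 _); rewrite (_ : Sub 1 _ = 1) ?rmorph1 //.
  by apply: val_inj; rewrite SubK.
have PB a b : P a -> P b -> P (a - b).
  case=> ha Ea [hb Eb]; exists (rpredB ha hb).
  rewrite (_ : Sub _ _ = Sub a ha - Sub b hb) ?rmorphB ?Ea ?Eb //.
  by apply: val_inj; rewrite raddfB !SubK.
have PM a b : P a -> P b -> P (a * b).
  case=> ha Ea [hb Eb]; exists (rpredM ha hb).
  rewrite (_ : Sub _ _ = Sub a ha * Sub b hb) ?rmorphM ?Ea ?Eb //.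
  by apply: val_inj; rewrite rmorphM !SubK.
have PV a (hV : a^-1 \in Diffbar_pred R r) : P a -> a \is a GRing.unit -> P a^-1.
  case=> ha Ea ua; exists hV.
  pose u : Diffbar R r := Sub a ha; pose w : Diffbar R r := Sub a^-1 hV.
  have uw : u * w = 1 by apply: val_inj; rewrite rmorphM !SubK mulrV.
  have wu : w * u = 1 by apply: val_inj; rewrite rmorphM !SubK mulVr.
  exact: (rmorph_eq_inv (f := rho) (g := rho_p) uw wu Ea).
have mem a : Diffbar_generator R r a -> a \in Diffbar_pred R r.
  exact: mem_subring_gen.
have Pc c : c \in R -> P (cop c).
  move=> cR; have h := mem _ (Diffbar_Diff r (Diff_scalar cR)); exists h.
  have [Hc _ _] := rhoP (Sub (cop c) h);
  have [Hc' _ _] := rho_p_is_rho_p (Sub (cop c) h).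
  by rewrite (Hc (Sub c cR)) ?(Hc' (Sub c cR)) ?SubK.
have Px : P (xop k).
  have h := mem _ (Diffbar_Diff r (Diff_x R)); exists h.
  have [_ Hx _] := rhoP (Sub (xop k) h);
  have [_ Hx' _] := rho_p_is_rho_p (Sub (xop k) h).
  by rewrite Hx ?Hx' ?SubK.
have Pd : P (dop k).
  have h := mem _ (Diffbar_Diff r (Diff_d R)); exists h.
  have [_ _ Hd] := rhoP (Sub (dop k) h);
  have [_ _ Hd'] := rho_p_is_rho_p (Sub (dop k) h).
  by rewrite Hd ?Hd' ?SubK.
have Pz (m : int) : P m%:~R.
  have [c cR ->] : exists2 c, c \in R & m%:~R = cop c.
    exists m%:~R; first exact: rpred_int.
    by rewrite fop_int /cop !rmorph_int.
  exact: Pc.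
move=> u; suff [h E] : P (val u).
  by rewrite (_ : u = Sub (val u) h) //; apply: val_inj; rewrite SubK.
apply: (subring_gen_ind P1 PB PM) (valP u) => a Ga.
case: (Ga) => [_ [c cR|||] | i m].
- exact: Pc.
- exact: Px.
- apply: PV => //; [exact/mem/Diffbar_Diff/Diff_xV | exact: xop_unit].
- exact: Pd.
apply: PV; first exact/mem/Diffbar_inv.
  rewrite -[m%:~R]opprK -mulrNz; apply: (PB); last exact: Pz.
  by apply: PB; [exact: PM | exact: Pc].
exact: theta_shift_unit.
Qed.

Lemma exists_rho_p : exists rho, @is_rho_p k R n r p I rho.
Proof. by exists rho_p; exact: rho_p_is_rho_p. Qed.

Lemma mxtrace_is_rho_p (rho : {rmorphism Diffbar R r -> 'M[K]_p}) (u : Diffbar R r)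
    (M : nat) (a : {poly B}) (L : seq (B * J * nat)) :
    is_rho_p rho -> (forall j : int, j \in msupp (val u) -> (`|j| < p)%N) ->
    M%:R * (val u)@_0 = polyF val_R a + polar_part val_R shifted_root L ->
    (size a <= n')%N -> all (fun t => t.2 <= n')%N L ->
  M%:R * \tr (rho u) = (map_poly base_change (pole_poly L)).[(- s)^-1].
Proof.
move=> rhoP lt_p uE le_a le_L; have Su := Diffbar_theta_diffop (valP u).
rewrite (is_rho_p_uniq rhoP) -[rho_p u]/(diffop_mx _ _ _ X D (val u)).
rewrite (mxtrace_diffop val_R_inj p_pr base_change_natr0 mx_x_unit s_unit
  mx_dx mx_xd_expp base_change_root) //.
exact: (mxtrace_pfrac val_R_inj p_pr base_change_natr0 mx_x_unit s_unit
  mx_dx mx_xd_expp mxtrace_mx_xd base_change_root _ uE).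
Qed.

End ModP.
End BaseChange.

(** One polynomial q in 1/eps, with coefficients in R[1/m], expresses the right-hand side. Its
    reduction [qp] evaluated at eps = -xi^p eta^p is the trace; existence of [rho] is asserted too,
    so the trace formula is not vacuous. *)
Theorem theorem2p1
  (k : fieldType) (k_char0 : [pchar k] =i pred0)
  (kbar : closedFieldType) (iota : {rmorphism k -> kbar})
  (kbar_alg : forall z : kbar, algebraicOver iota z)
  (T : {fraction {poly kbar}} -> {fraction {poly kbar}}) (T_eps : is_T_eps T)
  (R : subringClosed k) (R_fg : fin_gen_over_Z R)
  (n : nat) (r : 'I_n -> rat) (r_in_R : forall j, ratr (r j) \in R)
  (N : nat) (D : 'I_N -> diffop k) (D_in_Diff : forall i, D i \in Diff R)
  (A : Diffbar R r)
  (A_def : val A = (opP k r)^-1 * \prod_(i < N) (D i * (opP k r)^-1)) :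
  exists (C m : nat) (q : {poly k}),
    [/\ (0 < m)%N,
        forall j : nat, exists e : nat, q`_j * m%:R ^+ e \in R,
        T (frac_map (map_poly iota) (rho_eps (val A) (xeps k 0))@_0)
          = (map_poly (fun c => (iota c)%:P%:F) q).['X%:F^-1]
      & forall p : nat, prime p -> (C < p)%N ->
        ~~ (p %| m)%N /\
        forall I : idealr (subring_type R), is_pideal p I ->
          (exists rho, @is_rho_p k R n r p I rho) /\
          forall rho, @is_rho_p k R n r p I rho ->
            exists qp : {poly {ideal_quot I}},
              (forall j : nat, reduces_to m q`_j qp`_j) /\
              \tr (rho A) =
                (map_poly (@scal k R I) qp).[(- (xi_elt I ^+ p * eta_elt I ^+ p))^-1]].
Proof.
have SA := Diffbar_theta_diffop r_in_R (valP A).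
have rdiff := shifted_root_diff k_char0 r_in_R.
have v_inj := @val_R_inj k R.
have [M [a [L [M_gt0 fE]]]] := theta_ring_pfrac v_inj rdiff (SA 0).
pose supp_bound := \max_(j <- msupp (val A)) `|j|%N.
pose denq_bound := \max_(j < n) `|denq (r j)|%N.
pose pole_bound := \max_(t <- L) t.2.+1.
(* A prime above C does not divide M or any denominator, and exceeds the pole orders, the size of
   the polynomial part and the absolute values of the exponents of x in A. *)
pose C := maxn M (maxn (size a) (maxn pole_bound (maxn supp_bound denq_bound))).
pose Q := pole_poly L.
have M0 : M%:R != 0 :> k by rewrite pmulrn (intr_eq0_char0 k_char0) eqz_nat -lt0n.
(* [Q] has coefficients in R, so a single factor M clears the denominators of q. *)
exists C, M, (M%:R^-1 *: map_poly (val_R R) Q); split=> //.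
- move=> j; exists 1%N; rewrite coefZ coef_map expr1 mulrAC mulVf // mul1r.
  exact: valP.
(* [rho_eps] is left multiplication in normal form, and x^eps corresponds to the unit operator. *)
- have -> : (rho_eps (val A) (xeps k 0))@_0 = (val A)@_0.
    by rewrite rho_epsE [dmul _ _](mulr1 (val A)).
  pose g : {rmorphism k -> {fraction {poly kbar}}} :=
    (@FracField.tofrac {poly kbar} \o polyC \o iota).
  rewrite -[map_poly _ _]/(map_poly g _) map_polyZ hornerZ -map_poly_comp.
  rewrite (horner_pole_poly (g \o val_R R)) /=.
  rewrite -(T_eps_pfrac iota v_inj T_eps fE) -[tofrac _]/(g _) fmorphV rmorph_nat.
  by rewrite mulKf // -(rmorph_nat g) fmorph_eq0.
case=> // n' p_pr; rewrite !gtn_max => /and5P[lt_M lt_a lt_L lt_supp lt_denq].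
split; first by rewrite gtnNdvd.
move=> I Ip.
have lt_d j : (`|denq (r j)| < n'.+1)%N.
  by apply: leq_ltn_trans lt_denq; apply: (@leq_bigmax _ (fun j => `|denq (r j)|%N)).
split; first exact: (exists_rho_p k_char0 r_in_R p_pr Ip lt_d).
move=> rho rhoP.
have supp_lt (j : int) : j \in msupp (val A) -> (`|j| < n'.+1)%N.
  move=> jA; apply: leq_ltn_trans lt_supp.
  exact: (@leq_bigmax_seq _ _ xpredT (fun j : int => `|j|%N)).
have poles_le : all (fun t => t.2 <= n')%N L.
  apply/allP => t tL; rewrite -ltnS ltnW //; apply: leq_ltn_trans lt_L.
  exact: (@leq_bigmax_seq _ _ xpredT (fun t : _ * nat => t.2.+1)).
have trE := mxtrace_is_rho_p k_char0 p_pr Ip lt_d rhoP supp_lt fE lt_a poles_le.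
have [|w wE] := natr_inv p_pr (mod_p_natr0 Ip) (m := M); first by rewrite gtnNdvd.
(* Modulo p the inverse [w] of M replaces the scalar 1/M of q. *)
exists (w%:R *: map_poly (mod_p I) Q); split.
  move=> j; exists 1%N, (Q`_j); split.
    by rewrite coefZ coef_map expr1 mulrAC mulVf // mul1r.
  by rewrite coefZ coef_map expr1 mulrAC wE mul1r.
rewrite -[map_poly _ _]/(map_poly (scal_rmorph I) _) map_polyZ hornerZ.
rewrite -map_poly_comp -[map_poly _ Q]/(map_poly (base_change I) Q) -trE mulrA.
have -> : scal_rmorph I w%:R * M%:R = 1.
  by rewrite -(rmorph_nat (scal_rmorph I)) -rmorphM wE rmorph1.
by rewrite mul1r.
Qed.
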